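(* Let $X$ be a locally connected one-dimensional metric continuum. The following conditions are equivalent: (1) $X\in LPPP$; (2) $X\in wLPPP$; (3) $X$ is a local dendrite; (4) $X\in LFPP$; (5) $X\in wLFPP$.
   Context: A metric continuum is a nonempty compact connected metrizable space; one-dimensional means topological (covering) dimension equal to 1. A dendrite is a locally connected metric continuum containing no simple closed curve (a simple closed curve is a homeomorphic copy of the circle). A continuum is a local dendrite if each of its points has a closed neighborhood which is a dendrite. A periodic point of a map $f:X\to X$ is a point $x\in X$ with $f^n(x)=x$ for some integer $n\ge 1$. A topological space $X$ has the fixed point property ($X\in FPP$) if each continuous map $f:X\to X$ has a fixed point; $X$ has the periodic point property ($X\in PPP$) if each continuous map $f:X\to X$ has a periodic point. $X$ has the local fixed point property ($X\in LFPP$) if $X$ has an open basis $\mathcal{B}$ such that $\overline{B}\in FPP$ for each $B\in\mathcal{B}$. $X$ has the weak local fixed point property ($X\in wLFPP$) if $X$ has an open basis $\mathcal{B}$ such that, for each $B\in\mathcal{B}$ and each continuous map $f:X\to X$, whenever $f(\overline{B})\subset B$, then $f$ has a fixed point in $B$. $X$ has the local periodic point property ($X\in LPPP$) if $X$ has an open basis $\mathcal{B}$ such that $\overline{B}\in PPP$ for each $B\in\mathcal{B}$. $X$ has the weak local periodic point property ($X\in wLPPP$) if $X$ has an open basis $\mathcal{B}$ such that, for each $B\in\mathcal{B}$ and each continuous map $f:X\to X$, whenever $f(\overline{B})\subset B$, then $f$ has a periodic point in $B$. Here $\overline{B}$ is the closure of $B$ in $X$ (with the subspace topology), and bases are understood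 to consist of nonempty open sets. *)

(* Defs.v *)
From HB Require Import structures.
From mathcomp Require Import all_boot all_order all_algebra.
From mathcomp Require Import all_classical all_reals topology.

Set Implicit Arguments.
Unset Strict Implicit.
Unset Printing Implicit Defensive.

Import Order.TTheory GRing.Theory Num.Theory.
Import numFieldTopology.Exports.

Local Open Scope classical_set_scope.
Local Open Scope ring_scope.

(* A subset [A] of a topological space is regarded as a space through
   [set_type A], which carries the subspace (initial) topology. *)

Definition homeomorphic (S T : topologicalType) : Prop :=
  exists (f : S -> T) (g : T -> S),
    [/\ cancel f g, cancel g f, continuous f & continuous g].

Definition metrizable (R : realType) (T : topologicalType) : Prop :=
  exists M : metricType R, homeomorphic T M.

Definition metric_continuum (R : realType) (T : topologicalType) : Prop :=
  [/\ [set: T] !=set0, compact [set: T], connected [set: T] & metrizable R T].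

Definition locally_connected (T : topologicalType) : Prop :=
  forall (x : T) (U : set T), nbhs x U ->
    exists V : set T, [/\ open V, V x, connected V & V `<=` U].

Definition open_cover (T : topologicalType) (C : set (set T)) : Prop :=
  C `<=` open /\ \bigcup_(U in C) U = [set: T].

Definition refines (T : Type) (D C : set (set T)) : Prop :=
  forall V, D V -> exists2 U, C U & V `<=` U.

(* Lebesgue covering dimension at most [n]: every finite open cover has a
   finite open refinement in which no point lies in more than [n + 1] members. *)
Definition covering_dim_le (T : topologicalType) (n : nat) : Prop :=
  forall C : set (set T), finite_set C -> open_cover C ->
    exists D : set (set T),
      [/\ finite_set D, open_cover D, refines D C
        & forall x : T, ([set V | D V /\ V x] #<= `I_n.+1)%card].

(* The dimension -1 of the empty space is not accounted for, so this is only
   meaningful for nonempty [T]. *)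
Definition covering_dim_eq (T : topologicalType) (n : nat) : Prop :=
  covering_dim_le T n /\ forall m, covering_dim_le T m -> (n <= m)%N.

Definition one_dimensional (T : topologicalType) : Prop := covering_dim_eq T 1.

Definition circle (R : realType) : set (R * R) :=
  [set p | p.1 ^+ 2 + p.2 ^+ 2 = 1].

Definition simple_closed_curve (R : realType) (T : topologicalType)
    (A : set T) : Prop :=
  homeomorphic (set_type (@circle R)) (set_type A).

Definition dendrite (R : realType) (T : topologicalType) : Prop :=
  [/\ metric_continuum R T, locally_connected T
    & ~ exists A : set T, simple_closed_curve R A].

Definition local_dendrite (R : realType) (T : topologicalType) : Prop :=
  metric_continuum R T /\
  forall x : T, exists N : set T,
    [/\ closed N, nbhs x N & dendrite R (set_type N)].

Definition periodic_point (T : Type) (f : T -> T) (x : T) : Prop :=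
  exists2 n : nat, (1 <= n)%N & iter n f x = x.

Definition FPP (T : topologicalType) : Prop :=
  forall f : T -> T, continuous f -> exists x, f x = x.

Definition PPP (T : topologicalType) : Prop :=
  forall f : T -> T, continuous f -> exists x, periodic_point f x.

Definition nonempty_basis (T : topologicalType) (B : set (set T)) : Prop :=
  basis B /\ forall U, B U -> U !=set0.

Definition LFPP (T : topologicalType) : Prop :=
  exists2 B : set (set T), nonempty_basis B &
    forall U, B U -> FPP (set_type (closure U)).

Definition wLFPP (T : topologicalType) : Prop :=
  exists2 B : set (set T), nonempty_basis B &
    forall (U : set T) (f : T -> T), B U -> continuous f ->
      f @` closure U `<=` U -> exists2 x, U x & f x = x.

Definition LPPP (T : topologicalType) : Prop :=
  exists2 B : set (set T), nonempty_basis B &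
    forall U, B U -> PPP (set_type (closure U)).

Definition wLPPP (T : topologicalType) : Prop :=
  exists2 B : set (set T), nonempty_basis B &
    forall (U : set T) (f : T -> T), B U -> continuous f ->
      f @` closure U `<=` U -> exists2 x, U x & periodic_point f x.

(* Main.v *)
From HB Require Import structures.
Require Import Defs.
From mathcomp Require Import all_boot all_order all_algebra.
From mathcomp Require Import all_classical all_reals topology.
From mathcomp Require Import normedtype realfun numfun.
From mathcomp Require Import finmap ring lra zify.

Set Implicit Arguments.
Unset Strict Implicit.
Unset Printing Implicit Defensive.

Import Order.TTheory GRing.Theory Num.Theory.
Import numFieldNormedType.Exports.

Local Open Scope classical_set_scope.
Local Open Scope ring_scope.

(** The restriction of a map f with f(cl B) inside B to cl B shows at once that
    each local property implies its weak form, and fixed points are periodic.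
    Two implications carry the theorem.

    If X has the weak local periodic point property, then it is a local
    dendrite.  Around each point x the space X has arbitrarily small connected
    open sets B whose closure is again locally connected
    ([locally_connected_closure_nbhd]).  If no such closure near x is a dendrite,
    then every neighbourhood of x contains a simple closed curve S.  Take one in
    a member B of the basis.  As X is one-dimensional, the identity of S extends
    to a retraction of X onto S ([circle_extension]), and the retraction followed
    by a rotation of infinite order is a map of X into S, hence into B, without
    periodic points ([curve_aperiodic_map]).

    If X is a local dendrite, then closures of small connected open sets as
    above are dendrites, and a dendrite has the fixed point property
    ([dendrite_FPP]).  The only use made of the absence of simple closed curves
    is [separating_points]: if x and z are distinct, some points y arbitrarily
    close to x separate x from z.  Indeed let h be an arc from x to z and y a
    point of h; if y does not separate x from z, a path from x to z avoids y, and
    the part of it that jumps from one side of y on h to the other closes up to a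
    simple closed curve with a part of h ([arc_bypass_curve]).  Given a map f
    without fixed points, let C(x) be the component of X minus x containing f(x).
    By compactness the sets C(x) together with x have a minimal member for
    inclusion, while a point y close to x that separates x from f(x) gives a
    strictly smaller one.

    Arcs are obtained in two steps.  A compact locally connected space is
    uniformly locally connected, so a coarse chain of points can be refined again
    and again within controlled distance, and the limit is a path
    ([small_path]).  From a path one removes a maximal family of loops
    ([loop_erasure]); the result takes each value on an interval of parameters,
    and a continuous nondecreasing function that is constant exactly on these
    intervals ([height_function]) reparametrizes it injectively
    ([arc_of_path]). *)

(** * Metrics compatible with a topology *)

(** A distance function on the space itself, instead of a homeomorphism with a
    metric space, restricts to subspaces without any transport. *)
Record compatible_metric (R : realType) (T : topologicalType)
    (d : T -> T -> R) : Prop := CompatibleMetric {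
  dist_refl : forall x, d x x = 0;
  dist_sym : forall x y, d x y = d y x;
  dist_triangle : forall y x z, d x z <= d x y + d y z;
  dist_sep : forall x y, d x y = 0 -> x = y;
  dist_nbhs : forall x U,
    nbhs x U <-> exists2 e, 0 < e & forall y, d x y < e -> U y }.

Lemma metrizable_dist (R : realType) (T : topologicalType) :
  metrizable R T -> exists d : T -> T -> R, compatible_metric d.
Proof.
move=> [M [f [g [fK gK cf cg]]]]; exists (fun x y => mdist (f x) (f y)); split.
- by move=> x; rewrite mdistxx.
- by move=> x y; rewrite metric_sym.
- by move=> y x z; exact: metric_triangle.
- by move=> x y /mdist_positivity /(can_inj fK).
- move=> x U; split.
    rewrite -{1}(fK x) => /cg.
    rewrite nbhs_simpl/= -metricType_numDomainType.filter_from_mdist_nbhs => -[e /= e0 eU].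
    by exists e => // y fxy; have := eU _ fxy; rewrite /= fK.
  move=> [e e0 eU].
  have : nbhs x (f @^-1` (ball (f x) e)) by apply: cf; exact: nbhsx_ballx.
  by apply: filterS => y; rewrite /= ballEmdist => /= /eU.
Qed.

Section metric_topology.
Context (R : realType) (T : topologicalType) (d : T -> T -> R).
Hypothesis hd : compatible_metric d.
Let dxx := dist_refl hd.
Let dC := dist_sym hd.
Let dT := dist_triangle hd.

Lemma dist_ge0 x y : 0 <= d x y.
Proof. by have := dT y x x; rewrite dxx (dC y x); lra. Qed.

Lemma dist_gt0 x y : x <> y -> 0 < d x y.
Proof.
by move=> xy; rewrite lt_neqAle dist_ge0 andbT eq_sym; apply/eqP => /(dist_sep hd).
Qed.

Lemma nbhs_dball x e : 0 < e -> nbhs x [set y | d x y < e].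
Proof. by move=> e0; apply/(dist_nbhs hd); exists e. Qed.

Lemma dist_hausdorff : hausdorff_space T.
Proof.
move=> x y xy; apply: contrapT => /dist_gt0 xy0.
have e0 : 0 < d x y / 2 by rewrite divr_gt0.
have [z [/= xz yz]] := xy _ _ (nbhs_dball x e0) (nbhs_dball y e0).
by have := dT z x y; rewrite (dC z y); lra.
Qed.

Lemma dist_closureP (A : set T) x :
  closure A x <-> forall e, 0 < e -> exists2 y, A y & d x y < e.
Proof.
split=> [cx e e0|H U /(dist_nbhs hd)[e e0 eU]].
  by have [y [Ay xy]] := cx _ (nbhs_dball x e0); exists y.
by have [y Ay xy] := H _ e0; exists y; split=> //; exact: eU.
Qed.

Lemma dist_continuousP (S : topologicalType) (f : S -> T) :
  continuous f <->
  forall x e, 0 < e -> nbhs x [set y | d (f x) (f y) < e].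
Proof.
split=> [cf x e e0|H x U /(dist_nbhs hd)[e e0 eU]].
  exact: (cf x _ (nbhs_dball (f x) e0)).
by apply: filterS (H x e e0) => y /= /eU.
Qed.

Lemma lipschitz_continuous (f : T -> R) :
  (forall x y, `|f x - f y| <= d x y) -> continuous f.
Proof.
move=> H x; apply/cvgrPdist_lt => e e0.
by apply: filterS (nbhs_dball x e0) => y /=; exact: le_lt_trans.
Qed.

Lemma dist_continuous x : continuous (d x).
Proof.
apply: lipschitz_continuous => y z; rewrite ler_norml.
by have := dT z x y; have := dT y x z; rewrite (dC z y); lra.
Qed.

End metric_topology.

(** * Connectedness and local connectedness *)

(** Induction along a connected set: a property that is locally constant on it
    spreads from one point to all points. *)
Lemma connected_local_ind (T : topologicalType) (C : set T) (P : T -> Prop) x :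
  connected C -> C x -> P x ->
  (forall z, C z -> nbhs z [set w | C w -> (P z <-> P w)]) ->
  forall y, C y -> P y.
Proof.
move=> cC Cx Px loc.
pose O := [set w : T | nbhs w [set w' | C w' -> P w']].
pose N := [set w : T | nbhs w [set w' | C w' -> ~ P w']].
have oO (Q : T -> Prop) : open [set w : T | nbhs w Q].
  by rewrite openE => w /= /nbhs_interior.
suff <- : C `&` [set w | P w] = C by move=> y [].
apply: cC; first by exists x.
- exists O; first exact: oO.
  apply/seteqP; split=> w [Cw] /= Pw; split=> //.
    by rewrite /O/=; apply: filterS (loc _ Cw) => v /= /[apply] <-.
  by have := nbhs_singleton Pw; exact.
- exists (~` N); first by apply: open_closedC; exact: oO.
  apply/seteqP; split=> w [Cw] /= Pw; split=> //.
    by move=> /nbhs_singleton /(_ Cw).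
  apply: contrapT => nP; apply: Pw; rewrite /N/=.
  by apply: filterS (loc _ Cw) => v /= /[apply] <-.
Qed.

Lemma open_connected_component (T : topologicalType) (U : set T) x :
  locally_connected T -> open U -> open (connected_component U x).
Proof.
move=> lc oU; rewrite openE => y Uxy.
have Uy : U y by exact: connected_component_sub Uxy.
have [V [oV Vy cV VU]] := lc y U (open_nbhs_nbhs (conj oU Uy)).
apply: filterS (open_nbhs_nbhs (conj oV Vy)) => z Vz.
apply: connected_component_trans Uxy _.
by exists V.
Qed.

(** Being connected im kleinen at every point suffices: the component of an open
    set is then a neighbourhood of each of its points. *)
Lemma locally_connected_weak (T : topologicalType) :
  (forall (x : T) U, nbhs x U ->
    exists V : set T, [/\ nbhs x V, connected V & V `<=` U]) ->
  locally_connected T.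
Proof.
move=> H x U; rewrite nbhsE => -[W [oW Wx] WU].
exists (connected_component W x); split.
- rewrite openE => y Cy; have Wy := connected_component_sub Cy.
  have [V [nV cV VW]] := H y W (open_nbhs_nbhs (conj oW Wy)).
  have Vy := nbhs_singleton nV.
  apply: filterS nV => z Vz; apply: connected_component_trans Cy _.
  by exists V => //; split.
- exact: connected_component_refl.
- exact: component_connected.
- by apply: subset_trans WU; exact: connected_component_sub.
Qed.

Lemma uniformly_locally_connected (R : realType) (T : topologicalType)
    (d : T -> T -> R) (hd : compatible_metric d) :
  compact [set: T] -> locally_connected T ->
  forall e, 0 < e -> exists2 r, 0 < r & forall x y, d x y < r ->
    exists C, [/\ connected C, C x, C y & forall z, C z -> d x z < e].
Proof.
move=> cT lc e e0.
pose P (r : R) x := forall y, d x y < r ->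
    exists C, [/\ connected C, C x, C y & forall z, C z -> d x z < e].
have : \forall r \near 0^'+, [set: T] `<=` P r.
  have /compact_near_coveringP := cT; apply => x _.
  have e20 : 0 < e / 2 by rewrite divr_gt0.
  have [V [oV Vx cV VB]] := lc x _ (nbhs_dball hd x e20).
  have /(dist_nbhs hd)[s s0 sV] := open_nbhs_nbhs (conj oV Vx).
  have s20 : 0 < s / 2 by rewrite divr_gt0.
  exists ([set y | d x y < s / 2], [set r | r < s / 2]).
    split=> /=; first exact: nbhs_dball.
    exact: nbhs_right_lt.
  move=> [x' r] [/= xx' rs] y x'y; exists V; split=> //.
  - by apply: sV; lra.
  - by apply: sV; have := dist_triangle hd x' x y; lra.
  - move=> z /VB /= xz; have := dist_triangle hd x x' z.
    have /VB /= : V x' by apply: sV; lra.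
    by rewrite (dist_sym hd x' x); lra.
move=> near_r.
near (0:R)^'+ => r; exists r => // x y.
by have : [set: T] `<=` P r; [near: r | apply].
Unshelve. all: by end_near. Qed.

Lemma glue_continuous (R : realType) (S T : topologicalType)
    (l : S -> R) (f g : S -> T) :
  continuous l -> continuous f -> continuous g ->
  (forall p, l p = 0 -> f p = g p) ->
  continuous (fun p => if 0 <= l p then f p else g p).
Proof.
move=> cl cf cg fg p U; case: (ltgtP 0 (l p)) => [lp|lp|/esym lp] nU.
- have := cl p _ (@lt_nbhsr _ 0 _ lp).
  have := cf p U nU; rewrite /nbhs /=; apply: filterS2 => q /= Uq lq.
  by rewrite ltW.
- have := cl p _ (lt_nbhsl lp).
  have := cg p U nU; rewrite /nbhs /=; apply: filterS2 => q /= Uq lq.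
  by rewrite leNgt lq.
- have nU' := nU; rewrite (fg _ lp) in nU'.
  have := cf p U nU; have := cg p U nU'; rewrite /nbhs /=.
  by apply: filterS2 => q /= gq fq; case: ifP.
Qed.

(** * Paths in compact locally connected spaces *)

Lemma dependent_sequence (S : Type) (P : nat -> S -> Prop)
    (Q : nat -> S -> S -> Prop) s0 :
  P 0%N s0 ->
  (forall k s, P k s -> exists2 s', P k.+1 s' & Q k s s') ->
  exists f : nat -> S,
    [/\ f 0%N = s0, forall k, P k (f k) & forall k, Q k (f k) (f k.+1)].
Proof.
move=> P0 H.
have H' (ks : nat * S) : exists s',
    P ks.1 ks.2 -> P ks.1.+1 s' /\ Q ks.1 ks.2 s'.
  have [Pk|nPk] := pselect (P ks.1 ks.2); last by exists s0.
  by have [s' ? ?] := H _ _ Pk; exists s'.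
have [h hP] := choice H'.
pose f := fix F k := if k is k'.+1 then h (k', F k') else s0.
have Pf k : P k (f k) by elim: k => // k IH; have [] := hP (k, f k) IH.
by exists f; split=> // k; have [] := hP (k, f k) (Pf k).
Qed.

Lemma truncn_muln_div (R : realType) (x : R) N : (0 < N)%N ->
  (Num.truncn (x * N%:R) %/ N = Num.truncn x)%N.
Proof.
move=> N0; have NR0 : 0 < N%:R :> R by rewrite ltr0n.
have [x0|x0] := leP 0 x; last first.
  have xN : x * N%:R < 0 by rewrite pmulr_llt0.
  by rewrite !truncn_floor (leNgt 0 x) (leNgt 0 (x * _)) x0 xN /= div0n.
have xN0 : 0 <= x * N%:R by rewrite mulr_ge0.
have H n : (n <= Num.truncn (x * N%:R) %/ N)%N = (n <= Num.truncn x)%N.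
  by rewrite leq_divRL// !truncn_ge_nat// natrM ler_pM2r.
by apply/eqP; rewrite eqn_leq H -H !leqnn.
Qed.

Lemma truncn_dist1 (R : realType) (x y : R) : `|x - y| < 1 ->
  (Num.truncn y <= (Num.truncn x).+1)%N.
Proof.
move=> xy; rewrite truncn_le_nat; have := truncnS_gt x.
by move: xy; rewrite ltr_norml -[(Num.truncn x).+2%:R]natr1; lra.
Qed.

Lemma geometric_lt (R : realType) (a y : R) : 0 < y -> exists k, a / 2 ^+ k < y.
Proof.
move=> y0; exists (Num.truncn (a / y)).+1.
rewrite ltr_pdivrMr ?exprn_gt0// mulrC -ltr_pdivrMr//.
apply: lt_le_trans (truncnS_gt _) _; rewrite -natrX ler_nat.
exact/ltnW/ltn_expl.
Qed.

Section paths.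
Context (R : realType) (T : topologicalType) (d : T -> T -> R).
Hypothesis hd : compatible_metric d.

(** A substitute for completeness that keeps the explicit rate of convergence. *)
Lemma compact_telescope_limit (u : nat -> T) (c : nat -> R) :
  compact [set: T] -> (forall k j, d (u k) (u (k + j)%N) <= c k) ->
  exists p, forall k, d p (u k) <= c k.
Proof.
move=> cT uc.
have [p [_ clp]] := cT (u @ \oo) _ filterT.
exists p => k; apply/ler_addgt0Pl => e e0.
have nk : (u @ \oo) [set u n | n in [set n | (k <= n)%N]].
  by exists k => // n /= kn; exists n.
have [z [[n /= kn <-] pn]] := clp _ _ nk (nbhs_dball hd p e0).
have := dist_triangle hd (u n) p (u k); have := uc k (n - k)%N.
by rewrite subnKC// (dist_sym hd (u n)); move: pn => /=; lra.
Qed.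

Lemma connected_chain (C : set T) (r : R) x y :
  connected C -> 0 < r -> C x -> C y -> exists n (u : nat -> T),
    [/\ u 0%N = x, forall j, (n <= j)%N -> u j = y,
        forall j, C (u j) & forall j, d (u j) (u j.+1) < r].
Proof.
move=> cC r0 Cx.
pose P y := C y /\ exists n (u : nat -> T),
    [/\ u 0%N = x, forall j, (n <= j)%N -> u j = y,
        forall j, C (u j) & forall j, d (u j) (u j.+1) < r].
have ext z w : C w -> d z w < r -> P z -> P w.
  move=> Cw zw [Cz [n [u [u0 un Cu ur]]]]; split=> //.
  exists n.+1, (fun j => if (j <= n)%N then u j else w); split => //.
  - by move=> j nj; rewrite leqNgt nj.
  - by move=> j; case: ifP.
  - move=> j; have [jn|nj] := leqP j.+1 n; first by rewrite (ltnW jn).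
    case: ifP => jn; last by rewrite (dist_refl hd).
    by rewrite un //; lia.
suff H : P y -> C y -> exists n (u : nat -> T),
    [/\ u 0%N = x, forall j, (n <= j)%N -> u j = y,
        forall j, C (u j) & forall j, d (u j) (u j.+1) < r].
  move=> Cy; apply: H => //.
  apply: (connected_local_ind (P := P) cC Cx) => //.
    split=> //; exists 0%N, (fun=> x); split=> // j; by rewrite (dist_refl hd).
  move=> z Cz; apply: filterS (nbhs_dball hd z r0) => w /= zw Cw; split.
    exact: ext.
  by apply: ext => //; rewrite (dist_sym hd).
by move=> [].
Qed.

(** A chain is an eventually constant sequence of points; its parameter i / M runs
    through [0, 1].  Subdividing every step into the same number N of steps keeps
    the parametrizations of successive refinements comparable: the i-th point of
    the refinement lies over the (i %/ N)-th point of the original. *)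
Definition refinable (r e : R) := forall (s : R) (M : nat) (x : nat -> T),
  0 < s -> (forall i, d (x i) (x i.+1) < r) ->
  (forall i, (M <= i)%N -> x i = x M) ->
  exists N (x' : nat -> T), [/\ (0 < N)%N,
    forall i, d (x' i) (x' i.+1) < s,
    forall i, (M * N <= i)%N -> x' i = x' (M * N)%N,
    forall i, x' (i * N)%N = x i &
    forall i, d (x (i %/ N)%N) (x' i) < e].

(** Two consecutive points lie in a connected set of diameter of order e, which
    contains a chain of arbitrarily small step between them.  The finitely many
    chains are padded to a common length N. *)
Lemma refine_chain (e : R) : compact [set: T] -> locally_connected T -> 0 < e ->
  exists2 r : R, 0 < r & refinable r e.
Proof.
move=> cT lc e0; have [r r0 rC] := uniformly_locally_connected hd cT lc e0.
exists r => // s M x s0 xr xM.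
have /choice[n /choice[u Hu]] : forall i, exists n (u : nat -> T),
    [/\ u 0%N = x i, forall j, (n <= j)%N -> u j = x i.+1,
        forall j, d (x i) (u j) < e & forall j, d (u j) (u j.+1) < s].
  move=> i; have [C [cC Ci Ci1 CB]] := rC _ _ (xr i).
  have [n [u [u0 un Cu us]]] := connected_chain cC s0 Ci Ci1.
  by exists n, u; split=> // j; apply: CB.
pose N := (\max_(i < M) n i).+1.
have nN i : (i < M)%N -> (n i < N)%N.
  by move=> iM; rewrite /N ltnS; exact: (leq_bigmax (Ordinal iM)).
pose x' i := if (i %/ N < M)%N then u (i %/ N)%N (i %% N)%N else x M.
have x'M i : (M * N <= i)%N -> x' i = x M.
  by move=> Mi; rewrite /x' ltnNge leq_divRL// Mi.
have x'q q : x' (q * N)%N = x q.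
  rewrite /x' mulnK// modnMl; case: ltnP => [qM|/xM ->//].
  by have [] := Hu q.
exists N, x'; split=> //.
- move=> i; rewrite {1}/x'; case: ifPn => [iM|]; last first.
    rewrite -leqNgt leq_divRL// => Mi; rewrite x'M ?dist_refl//.
    exact: leq_trans Mi (leqnSn i).
  have [u0 un ue us] := Hu (i %/ N)%N.
  have [iN|Ni] := ltnP (i %% N).+1 N.
    have divE : (i.+1 %/ N = i %/ N)%N.
      rewrite {1}(divn_eq i N) -addnS divnMDl//.
      by rewrite (divn_small iN) addn0.
    have modE : (i.+1 %% N = (i %% N).+1)%N.
      by rewrite {1}(divn_eq i N) -addnS modnMDl modn_small.
    by rewrite /x' divE iM modE.
  have iE : i.+1 = ((i %/ N).+1 * N)%N.
    have := ltn_pmod i (ltn0Sn (\max_(i < M) n i)); rewrite -/N => lt.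
    by have := divn_eq i N; rewrite mulSn; lia.
  rewrite iE x'q -(un (i %% N).+1); first exact: us.
  by have := nN _ iM; lia.
- by move=> i Mi; rewrite !x'M.
- move=> i; rewrite /x'; case: ifP => [_|].
    by have [_ _ + _] := Hu (i %/ N)%N; apply.
  by move=> /negbT; rewrite -leqNgt => /xM ->; rewrite dist_refl.
Qed.

(** Local path connectedness with control on the distance: the path is the limit
    of successive refinements of the two-point chain, read at time t on the
    chain of length M at the index of the integral part of t * M. *)
Lemma small_path (e : R) : compact [set: T] -> locally_connected T -> 0 < e ->
  exists2 r : R, 0 < r & forall a b, d a b < r ->
    exists g : R -> T, [/\ continuous g, g 0 = a, g 1 = b &
      forall t, d a (g t) < e].
Proof.
move=> cT lc e0.
pose c k : R := e / 4 / 2 ^+ k.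
have c0 k : 0 < c k by rewrite !divr_gt0// exprn_gt0.
have cS k : c k.+1 = c k / 2 by rewrite /c exprS invfM; lra.
have /choice[dl Hdl] : forall k, exists r, 0 < r /\ refinable r (c k).
  by move=> k; have [r ? ?] := refine_chain cT lc (c0 k); exists r.
(* steps below dl k can be refined within distance c k, and steps below c k make
   the limit continuous *)
pose s k := Num.min (dl k) (c k).
have s0 k : 0 < s k by rewrite lt_min c0 (Hdl k).1.
exists (s 0%N) => // a b ab.
pose P k (S : nat * (nat -> T)) := [/\ (0 < S.1)%N,
  S.2 0%N = a, forall i, (S.1 <= i)%N -> S.2 i = b &
  forall i, d (S.2 i) (S.2 i.+1) < s k].
pose Q k (S S' : nat * (nat -> T)) := exists N, [/\ (0 < N)%N,
  S'.1 = (S.1 * N)%N & forall i, d (S.2 (i %/ N)%N) (S'.2 i) < c k].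
have [f [f0 Pf Qf]] : exists f : nat -> nat * (nat -> T),
    [/\ f 0%N = (1%N, fun i => if i is 0%N then a else b),
       forall k, P k (f k) & forall k, Q k (f k) (f k.+1)].
  apply: dependent_sequence.
    split=> //=; first by case.
    by case=> [|i] //; rewrite dist_refl.
  move=> k [M x] [/= M0 x0 xM xs].
  have xd i : d (x i) (x i.+1) < dl k.
    by apply: lt_le_trans (xs i) _; rewrite ge_min lexx.
  have xM' i : (M <= i)%N -> x i = x M by move=> Mi; rewrite !xM.
  have [N [x' [N0 x's x'M x'q x'c]]] := (Hdl k).2 _ M x (s0 k.+1) xd xM'.
  exists ((M * N)%N, x'); last by exists N.
  split=> //=; first by rewrite muln_gt0 M0.
    by rewrite -(mul0n N) x'q.
  by move=> i Mi; rewrite x'M// x'q xM.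
pose M k := (f k).1; pose x k := (f k).2.
have M0 k : (0 < M k)%N by have [] := Pf k.
have MR0 k : 0 < (M k)%:R :> R by rewrite ltr0n.
pose u (t : R) k := x k (Num.truncn (t * (M k)%:R)).
have uS t k : d (u t k) (u t k.+1) < c k.
  have [N [N0 MN xc]] := Qf k.
  rewrite /u /M MN natrM mulrA -(truncn_muln_div (t * (f k).1%:R) N0).
  exact: xc.
have uc t k j : d (u t k) (u t (k + j)%N) <= 2 * c k - 2 * c (k + j)%N.
  elim: j => [|j IH]; first by rewrite addn0 dist_refl// subrr.
  rewrite addnS cS; have := dist_triangle hd (u t (k + j)%N) (u t k) (u t (k + j).+1).
  by have := uS t (k + j)%N; lra.
have /choice[g gP] : forall t, exists p, forall k, d p (u t k) <= 2 * c k.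
  move=> t; apply: compact_telescope_limit => // k j.
  by apply: le_trans (uc t k j) _; have := c0 (k + j)%N; lra.
have c_small (y : R) : 0 < y -> exists k, c k < y by exact: geometric_lt.
have eqlim t p : (forall k, u t k = p) -> g t = p.
  move=> up; apply: contrapT => /(dist_gt0 hd) gp0.
  have [k ck] : exists k, c k < d (g t) p / 2 by apply: c_small; rewrite divr_gt0.
  by have := gP t k; rewrite up; lra.
exists g; split.
- apply/(dist_continuousP hd) => t y y0.
  have [k ck] := c_small (y / 5) (divr_gt0 y0 (ltr0n _ 5)).
  have : nbhs t (ball t (M k)%:R^-1) by apply: nbhsx_ballx; rewrite invr_gt0.
  apply: filterS => t' /=; rewrite /ball/= => tt'.
  suff : d (u t k) (u t' k) < c k.
    have := dist_triangle hd (u t k) (g t) (g t').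
    have := dist_triangle hd (u t' k) (u t k) (g t').
    by have := gP t k; have := gP t' k; rewrite (dist_sym hd (g t')); lra.
  have adj i j : (i <= j.+1)%N -> (j <= i.+1)%N -> d (x k i) (x k j) < c k.
    move=> ij ji; have [_ _ _ xs] := Pf k.
    have {}xs n : d (x k n) (x k n.+1) < c k.
      by apply: lt_le_trans (xs n) _; rewrite ge_min lexx orbT.
    have [ij'|[ij'|ij']] : i = j \/ i = j.+1 \/ j = i.+1 by lia.
    - by rewrite ij' dist_refl.
    - by rewrite ij' dist_sym.
    - by rewrite ij'.
  have tt'1 : `|t * (M k)%:R - t' * (M k)%:R| < 1.
    rewrite -mulrBl normrM (gtr0_norm (MR0 k)) -ltr_pdivlMr//.
    by rewrite div1r.
  by apply: adj; apply: truncn_dist1; rewrite // distrC.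
- by apply: eqlim => k; rewrite /u mul0r truncn0; have [] := Pf k.
- apply: eqlim => k; rewrite /u mul1r natrK; have [_ _ + _] := Pf k.
  by apply.
- move=> t.
  have := dist_triangle hd (u t 0%N) a (g t); rewrite (dist_sym hd (u t 0%N) (g t)).
  have := gP t 0%N; have /= -> : c 0%N = e / 4 by rewrite /c expr0 divr1.
  suff : d a (u t 0%N) < e / 4 by lra.
  rewrite /u /x f0/=; case: (Num.truncn _) => [|_]; first by rewrite dist_refl// divr_gt0.
  apply: lt_le_trans ab _; rewrite /s ge_min; apply/orP; right.
  by rewrite /c expr0 divr1.
Qed.

End paths.

(** Paths are defined on all of R, so that continuity needs no domain; only their
    values at 0 and 1 and the set containing their image matter. *)
Definition path_in (R : realType) (T : topologicalType) (A : set T) (x y : T) :=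
  exists g : R -> T, [/\ continuous g, g 0 = x, g 1 = y & forall t, A (g t)].

Lemma continuousT_comp (S T U : topologicalType) (f : S -> T) (g : T -> U) :
  continuous f -> continuous g -> continuous (fun x => g (f x)).
Proof. by move=> cf cg x; apply: continuous_comp; [exact: cf|exact: cg]. Qed.

Lemma affine_continuous (R : realType) (a b : R) :
  continuous (fun t : R => a * t + b).
Proof. by move=> t; apply: cvgD; [apply: cvgM; [exact: cvg_cst|exact: cvg_id]|exact: cvg_cst]. Qed.

Lemma reparametrized_continuous (R : realType) (T : topologicalType) (g : R -> T) (a b : R) :
  continuous g -> continuous (fun t : R => g (a * t + b)).
Proof.
move=> cg; apply: (@continuousT_comp R R T (fun t => a * t + b) g) => //.
exact: affine_continuous.
Qed.

Lemma path_in_trans (R : realType) (T : topologicalType) (A : set T) y x z :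
  path_in R A x y -> path_in R A y z -> path_in R A x z.
Proof.
move=> [f [cf f0 f1 fA]] [g [cg g0 g1 gA]].
exists (fun t => if 0 <= (-1) * t + 2^-1 then f (2 * t + 0) else g (2 * t + (-1))).
split=> [||| t]; last by case: ifP.
- apply: (@glue_continuous R R T (fun t => (-1) * t + 2^-1) (fun t => f (2 * t + 0))
    (fun t => g (2 * t + (-1)))); first exact: affine_continuous.
  + exact: reparametrized_continuous.
  + exact: reparametrized_continuous.
  + move=> t ht; have -> : t = 2^-1 by lra.
    have -> : 2 * 2^-1 + 0 = 1 :> R by lra.
    have -> : 2 * 2^-1 + -1 = 0 :> R by lra.
    by rewrite f1 g0.
- by rewrite !mulr0 add0r invr_ge0 ler0n addr0.
- rewrite ifN; last by rewrite -ltNge; lra.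
  by have -> : 2 * 1 + -1 = 1 :> R by lra.
Qed.

Lemma open_connected_path (R : realType) (T : topologicalType)
    (d : T -> T -> R) (hd : compatible_metric d) (G : set T) :
  compact [set: T] -> locally_connected T -> open G -> connected G ->
  forall x y, G x -> G y -> path_in R G x y.
Proof.
move=> cT lc oG cG x y Gx.
apply: (connected_local_ind (P := path_in R G x) cG Gx).
  by exists (fun=> x); split=> // t; exact: cvg_cst.
move=> z Gz.
have /(dist_nbhs hd)[e e0 eG] := open_nbhs_nbhs (conj oG Gz).
have e20 : 0 < e / 2 by rewrite divr_gt0.
have [r r0 rP] := small_path hd cT lc e20.
have m0 : 0 < Num.min r (e / 2) by rewrite lt_min r0.
apply: filterS (nbhs_dball hd z m0) => w /=; rewrite lt_min => /andP[zwr zwe] Gw.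
split=> Gxz.
  apply: path_in_trans Gxz _.
  have [g [cg g0 g1 gB]] := rP _ _ zwr.
  by exists g; split=> // t; apply: eG; have := gB t; lra.
apply: path_in_trans Gxz _.
have wzr : d w z < r by rewrite (dist_sym hd).
have [g [cg g0 g1 gB]] := rP _ _ wzr.
exists g; split=> // t; apply: eG; have := gB t.
by have := dist_triangle hd w z (g t); lra.
Qed.

(** * Arcs *)

Lemma compact_chain_cover (T : topologicalType) (F : set (set T)) (K : set T) :
  F `<=` open -> total_on F subset -> compact K -> K !=set0 ->
  K `<=` \bigcup_(O in F) O -> exists2 O, F O & K `<=` O.
Proof.
move=> oF tF cK [k0 Kk0] KF.
pose G := filter_from F (fun O => [set O' | F O' /\ O `<=` O']).
have FG : Filter G.
  apply: filter_from_filter; first by have [O FO _] := KF _ Kk0; exists O.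
  move=> O1 O2 F1 F2; have [O12|O21] := tF _ _ F1 F2.
    by exists O2 => // O' [FO' sO']; split; split=> //; apply: subset_trans sO'.
  by exists O1 => // O' [FO' sO']; split; split=> //; apply: subset_trans sO'.
have /compact_near_coveringP := cK.
move=> /(_ _ G (fun O x => O x) FG) near_G.
have [x /KF [O FO Ox]|O FO HO] := near_G _; last first.
  by exists O => // x Kx; exact: (HO O (conj FO (@subset_refl _ O)) x Kx).
exists (O, [set O' | F O' /\ O `<=` O']) => /=.
  split; last by exists O.
  by apply: open_nbhs_nbhs; split=> //; exact: oF.
by move=> [y O'] [/= Oy [_]]; exact.
Qed.

Lemma left_gap (R : realType) (O : set R) x : open O ->
  (exists2 u, u <= x & ~ O u) ->
  exists a, [/\ a <= x, ~ O a & forall u, a < u <= x -> O u].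
Proof.
move=> oO [u0 u0x nu0].
pose S := [set u | u <= x /\ ~ O u].
have hS : has_sup S by split; [exists u0 | exists x => u []].
have ubS u : u <= x -> ~ O u -> u <= sup S.
  by move=> ux nu; apply: (sup_upper_bound hS).
exists (sup S); split.
- by apply: ge_sup => [|u []//]; exists u0.
- move=> Oa; have [e /= e0 eO] : nbhs (sup S) O by apply: open_nbhs_nbhs.
  have [u [ux nu] ltu] := sup_adherent e0 hS.
  apply: (nu); apply: eO; rewrite /ball_/= ger0_norm; first by lra.
  by rewrite subr_ge0; apply: ubS.
- move=> u /andP[au ux]; apply: contrapT => nu.
  suff : u <= sup S by lra.
  exact: ubS.
Qed.

Lemma right_gap (R : realType) (O : set R) x : open O ->
  (exists2 u, x <= u & ~ O u) ->
  exists a, [/\ x <= a, ~ O a & forall u, x <= u < a -> O u].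
Proof.
move=> oO [u0 xu0 nu0].
have oO' : open ((fun u : R => - u) @^-1` O).
  by apply: open_comp => // u _; exact: opp_continuous.
have [|a [ax na aP]] := @left_gap R _ (- x) oO'.
  by exists (- u0); rewrite /= ?opprK// lerN2.
exists (- a); split=> //; first by rewrite lerNr.
move=> u /andP[xu ua]; have := aP (- u); rewrite /= opprK; apply.
by rewrite lerN2 xu andbT ltrNr.
Qed.

Section loop_erasure.
Context (R : realType) (T : topologicalType) (d : T -> T -> R).
Hypothesis hd : compatible_metric d.
Variable g : R -> T.
Hypothesis cg : continuous g.

(** A family of loops of the path g, encoded by the union O of the open intervals
    of parameters of these loops: the end points of each component of O have the
    same image. *)
Definition loops (O : set R) := [/\ open O, O `<=` `]0, 1[ &
  forall s t, s < t -> ~ O s -> ~ O t -> (forall u, s < u < t -> O u) ->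
    g s = g t].

Lemma path_ball s e : 0 < e ->
  exists2 r, 0 < r & forall u, `|s - u| < r -> d (g s) (g u) < e.
Proof.
move=> e0; have /(dist_continuousP hd)/(_ s e e0) := cg.
by move=> [r /= r0 rP]; exists r.
Qed.

(** A component of the union of a chain of such open sets is exhausted by
    components of the members, so the equality of the values at the end points
    passes to the limit. *)
Lemma loops_chain (F : set (set R)) : F `<=` loops -> total_on F subset ->
  loops (\bigcup_(O in F) O).
Proof.
move=> FL tF; split.
- by apply: bigcup_open => O /FL [].
- by move=> x [O /FL[_ + _]]; apply.
- move=> s t st nOs nOt gapO; apply: contrapT => /(dist_gt0 hd) D0.
  set D := d (g s) (g t) in D0.
  have D20 : 0 < D / 2 by rewrite divr_gt0.
  have [r1 r10 P1] := path_ball s D20.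
  have [r2 r20 P2] := path_ball t D20.
  pose r := Num.min (Num.min (r1 / 2) (r2 / 2)) ((t - s) / 4).
  have r0 : 0 < r by rewrite !lt_min !divr_gt0// subr_gt0.
  have rr1 : r < r1.
    have : r <= r1 / 2 by rewrite !ge_min lexx.
    by have := r10; lra.
  have rr2 : r < r2.
    have : r <= r2 / 2 by rewrite !ge_min lexx orbT.
    by have := r20; lra.
  have rts : r <= (t - s) / 4 by rewrite !ge_min lexx orbT.
  pose K : set R := `[s + r, t - r]%classic.
  have K0 : K !=set0.
    by exists (s + r); rewrite /K /= in_itv/= lexx/=; lra.
  have KF : K `<=` \bigcup_(O in F) O.
    by move=> u; rewrite /K /= in_itv/= => /andP[? ?]; apply: gapO; lra.
  have oF : F `<=` open by move=> O /FL [].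
  have [O FO KO] := compact_chain_cover oF tF (@segment_compact _ _ _) K0 KF.
  have [oO _ gO] := FL _ FO.
  have nO u : ~ (\bigcup_(O in F) O) u -> ~ O u by move=> nu Ou; apply: nu; exists O.
  have [|a [ax na aP]] := @left_gap R O (s + r) oO.
    by exists s; [lra|exact: nO].
  have [|b [bx nb bP]] := @right_gap R O (t - r) oO.
    by exists t; [lra|exact: nO].
  have sa : s <= a.
    by rewrite leNgt; apply/negP => sa; apply: (nO _ nOs); apply: aP; lra.
  have bt : b <= t.
    by rewrite leNgt; apply/negP => sa'; apply: (nO _ nOt); apply: bP; lra.
  have gab : g a = g b.
    apply: gO => //; first by lra.
    move=> u /andP[au ub]; have [us|us] := leP u (s + r); first by apply: aP; lra.
    have [ut|ut] := leP (t - r) u; first by apply: bP; lra.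
    by apply: KO; rewrite /= in_itv/=; lra.
  have h1 : d (g s) (g a) < D / 2.
    by apply: P1; rewrite ltr_norml; lra.
  have h2 : d (g t) (g b) < D / 2.
    by apply: P2; rewrite ltr_norml; lra.
  have := dist_triangle hd (g a) (g s) (g t).
  by move: h2; rewrite -gab (dist_sym hd (g t)) -/D; lra.
Qed.

(** Let O be a maximal family of loops.  If g takes the same value at two
    parameters outside O, then the interval between them can be added to O, so it
    lies in O already.  The path h takes at t the value of g at the last
    parameter up to t that is outside O. *)
Lemma loop_erasure : exists h : R -> T, [/\ continuous h, h 0 = g 0, h 1 = g 1,
   forall t, 0 <= t <= 1 -> exists2 s, 0 <= s <= 1 & h t = g s &
   forall s t u, 0 <= s -> s <= u -> u <= t -> t <= 1 -> h s = h t -> h u = h s].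
Proof.
have [O [LO maxO]] := Zorn_bigcup loops_chain.
have [oO O01 gO] := LO.
have nO x : ~ (0 < x < 1) -> ~ O x by move=> nx /O01; rewrite /= in_itv/=.
have gmax u v : 0 <= u -> u < v -> v <= 1 -> ~ O u -> ~ O v -> g u = g v ->
    forall w, u < w < v -> O w.
  move=> u0 uv v1 nu nv guv.
  pose O' := O `|` `]u, v[.
  suff LO' : loops O'.
    move=> w uwv; apply: contrapT => nw; apply: (maxO O') => //.
    split; first by move=> ?; left.
    by move=> /(_ w) Ow; apply/nw/Ow; right; rewrite /= in_itv.
  split.
  - by apply: openU => //; exact: interval_open.
  - by move=> w [/O01//|]; rewrite /= !in_itv/=; lra.
  move=> s t st nOs nOt gapO.
  have ns : ~ O s by move=> ?; apply: nOs; left.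
  have nt : ~ O t by move=> ?; apply: nOt; left.
  have nsuv : ~ (u < s < v) by move=> ?; apply: nOs; right; rewrite /= in_itv.
  have ntuv : ~ (u < t < v) by move=> ?; apply: nOt; right; rewrite /= in_itv.
  have gapO1 w : s < w < t -> ~ (u < w < v) -> O w.
    by move=> /gapO [//|]; rewrite /= in_itv.
  have [su|su] := leP s u; last first.
    have vs : v <= s by rewrite leNgt; apply/negP => ?; apply: nsuv; rewrite su.
    by apply: gO => // w /andP[sw wt]; apply: gapO1; rewrite ?sw//; lra.
  have [tv|tv] := ltP t v.
    have tu : t <= u by rewrite leNgt; apply/negP => ?; apply: ntuv; apply/andP.
    by apply: gO => // w /andP[sw wt]; apply: gapO1; rewrite ?sw//; lra.
  have -> : g s = g u.
    have [->//|su'] := eqVneq s u.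
    have {}su : s < u by rewrite lt_neqAle su'.
    by apply: gO => // w /andP[sw wt]; apply: gapO1; lra.
  rewrite guv; have [->//|tv'] := eqVneq t v.
  have {}tv : v < t by rewrite lt_neqAle eq_sym tv'.
  by apply: gO => // w /andP[sw wt]; apply: gapO1; lra.
have /choice[k kP] : forall x, exists a, [/\ a <= x, ~ O a &
    forall u, a < u <= x -> O u].
  move=> x; apply: left_gap => //; exists (Num.min x 0).
    by rewrite ge_min lexx.
  apply: nO; suff : Num.min x 0 <= 0 by lra.
  by rewrite ge_min lexx orbT.
have kle x : k x <= x by have [] := kP x.
have knO x : ~ O (k x) by have [] := kP x.
have kgap x u : k x < u <= x -> O u by have [_ _] := kP x; apply.
have kid x : ~ O x -> k x = x.
  move=> nx; apply/eqP; rewrite eq_le kle leNgt; apply/negP => kx; apply: nx.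
  by apply: (kgap x); rewrite kx lexx.
have kmono x y : x <= y -> k x <= k y.
  move=> xy; rewrite leNgt; apply/negP => kyx; apply: (knO x).
  by apply: (kgap y); rewrite kyx (le_trans (kle x)).
have k0 : k 0 = 0 by apply: kid; apply: nO; lra.
have k1 : k 1 = 1 by apply: kid; apply: nO; lra.
exists (g \o k); split; rewrite /=.
- apply/(dist_continuousP hd) => t e e0.
  have [Ot|nt] := pselect (O t).
    have : nbhs t O by exact: open_nbhs_nbhs.
    move=> [r /= r0 rO].
    exists r => //= s str /=.
    suff -> : k s = k t by rewrite dist_refl.
    have ball_O w : (t <= w <= s) || (s <= w <= t) -> O w.
      move=> tws; apply: rO; apply: le_lt_trans str; rewrite /=.
      case/orP: tws => /andP[w1 w2].
        by rewrite !ler0_norm; lra.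
      by rewrite !ger0_norm; lra.
    apply/eqP; rewrite eq_le; apply/andP; split; rewrite leNgt; apply/negP => kk.
      apply: (knO s); have [st|/ltW st] := leP (k s) t.
        by apply: (kgap t); rewrite kk st.
      by apply: ball_O; rewrite st kle.
    apply: (knO t); have [st|/ltW st] := leP (k t) s.
      by apply: (kgap s); rewrite kk st.
    by apply: ball_O; rewrite st kle orbT.
  rewrite /= (kid _ nt).
  have [r r0 rP] := path_ball t e0.
  have [[u [ru ut nu]]|nou] := pselect (exists u, [/\ t - r < u, u < t & ~ O u]).
    exists (t - u); rewrite /= ?subr_gt0// => s /=; rewrite ltr_norml => /andP[ts1 ts2].
    apply: rP.
    have := kle s; have := kmono u s; rewrite (kid _ nu) => h1 h2.
    have {}h1 : u <= k s by apply: h1; lra.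
    have [ts|ts] := leP t s.
      have := kmono t s ts; rewrite (kid _ nt) => ?.
      by rewrite ltr_norml; lra.
    by rewrite ltr_norml; lra.
  exists r => //= s /=; rewrite ltr_norml => /andP[ts1 ts2].
  have [ts|ts] := leP t s.
    have := kmono t s ts; rewrite (kid _ nt) => ?.
    by apply: rP; have := kle s; rewrite ltr_norml; lra.
  suff -> : g (k s) = g t by rewrite dist_refl.
  apply: gO => //; first by have := kle s; lra.
  move=> w /andP[kw wt]; have [ws|ws] := leP w s; first by apply: (kgap s); rewrite kw.
  by apply: contrapT => nw; apply: nou; exists w; split=> //; lra.
- by rewrite k0.
- by rewrite k1.
- move=> t /andP[t0 t1]; exists (k t) => //.
  by have := kmono _ _ t0; have := kmono _ _ t1; rewrite k0 k1 => -> ->.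
- move=> s t u s0 su ut t1 gst.
  have := kmono _ _ su; have := kmono _ _ ut.
  have := kmono _ _ s0; have := kmono _ _ t1; rewrite k0 k1 => ? ? kut ksu.
  have [->//|ksu'] := eqVneq (k u) (k s).
  have [->//|kut'] := eqVneq (k u) (k t).
  exfalso; apply: (knO u); apply: (@gmax (k s) (k t)) => //.
    by rewrite (lt_le_trans _ kut)// lt_neqAle eq_sym ksu'.
  by rewrite !lt_neqAle ksu kut (eq_sym (k s)) ksu' kut'.
Qed.

End loop_erasure.

Lemma sum_continuous (R : realType) (S : topologicalType) (F : nat -> S -> R) n :
  (forall k, continuous (F k)) -> continuous (fun t => \sum_(k < n) F k t).
Proof.
move=> cF; elim: n => [|n IH].
  have -> : (fun t => \sum_(k < 0) F k t) = fun=> 0.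
    by apply/funext => t; rewrite big_ord0.
  by move=> t; exact: cvg_cst.
have -> : (fun t => \sum_(k < n.+1) F k t) = fun t => \sum_(k < n) F k t + F n t.
  by apply/funext => t; rewrite big_ord_recr.
by move=> t; apply: cvgD; [exact: IH|exact: cF].
Qed.

(** Summing with weights 2^-(k+1) merges countably many continuous functions into
    one that increases between two points as soon as one of them does and none
    decreases.  The limit is defined as a supremum of partial sums. *)
Lemma weighted_sum (R : realType) (S : topologicalType) (F : nat -> S -> R) :
  (forall k, continuous (F k)) -> (forall k t, 0 <= F k t <= 1) ->
  exists phi : S -> R, [/\ continuous phi,
    forall s t, (forall k, F k s <= F k t) -> phi s <= phi t &
    forall s t n, (forall k, F k s <= F k t) -> F n s < F n t -> phi s < phi t].
Proof.
move=> cF F01.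
pose w k : R := 1 / 2 ^+ k.
have w0 k : 0 < w k by rewrite divr_gt0// exprn_gt0.
have wS k : w k = w k.+1 + w k.+1 by rewrite /w exprS invfM; lra.
pose p N t := \sum_(k < N) (w k.+1 * F k t).
have pS N t : p N.+1 t = p N t + w N.+1 * F N t by rewrite /p big_ord_recr.
have wF0 k t : 0 <= w k.+1 * F k t.
  by have /andP[? _] := F01 k t; rewrite mulr_ge0// ltW.
have wF1 k t : w k.+1 * F k t <= w k.+1.
  by have /andP[_ ?] := F01 k t; rewrite ler_piMr// ltW.
have pmono N j t : p N t <= p (N + j)%N t.
  elim: j => [|j IH]; first by rewrite addn0.
  by rewrite addnS pS; have := wF0 (N + j)%N t; lra.
have pbound N j t : p (N + j)%N t <= p N t + w N - w (N + j)%N.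
  elim: j => [|j IH]; first by rewrite addn0; lra.
  rewrite addnS pS; have := wF1 (N + j)%N t; have := wS (N + j)%N.
  by lra.
pose E t := [set p N t | N in setT].
have hE t : has_sup (E t).
  split; first by exists (p 0%N t); exists 0%N.
  exists (p 0%N t + w 0%N) => _ [N _ <-].
  by have := pbound 0%N N t; rewrite add0n; have := w0 N; lra.
pose phi t := sup (E t).
have p_phi N t : p N t <= phi t by apply: (sup_upper_bound (hE t)); exists N.
have phi_le t c : (forall N, p N t <= c) -> phi t <= c.
  by move=> pc; apply: ge_sup => [|_ [N _ <-]//]; case: (hE t).
have phi_p N t : phi t <= p N t + w N.
  apply: phi_le => n; have [nN|/ltnW Nn] := leqP n N.
    by have := pmono n (N - n)%N t; rewrite subnKC//; have := w0 N; lra.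
  by have := pbound N (n - N)%N t; rewrite subnKC//; have := w0 n; lra.
have p_le N s t : (forall k, F k s <= F k t) -> p N s <= p N t.
  by move=> Fst; apply: ler_sum => k _; apply: ler_wpM2l => //; exact: ltW.
exists phi; split.
- move=> t; apply/cvgrPdist_lt => e e0.
  have [N wN] := geometric_lt 1 (divr_gt0 e0 (ltr0n _ 3)).
  have cp : continuous (p N).
    apply: (@sum_continuous R S (fun k t => w k.+1 * F k t)) => k u.
    by apply: cvgM; [exact: cvg_cst|exact: cF].
  have /cvgrPdist_lt/(_ (e / 3) (divr_gt0 e0 (ltr0n _ 3))) := cp t.
  apply: filterS => u; rewrite !ltr_norml => /andP[? ?].
  have := phi_p N t; have := phi_p N u; have := p_phi N t; have := p_phi N u.
  by rewrite -/(w N) in wN; lra.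
- by move=> s t Fst; apply: phi_le => N; apply: le_trans (p_phi N t); exact: p_le.
- move=> s t n Fst Fn.
  have dlt : 0 < w n.+1 * (F n t - F n s) by rewrite mulr_gt0// subr_gt0.
  suff : phi s <= phi t - w n.+1 * (F n t - F n s) by lra.
  apply: phi_le => N.
  have big m : p (n.+1 + m)%N s + w n.+1 * (F n t - F n s) <= p (n.+1 + m)%N t.
    elim: m => [|m IH]; first by rewrite addn0 !pS; have := p_le n _ _ Fst; lra.
    rewrite addnS (pS (n.+1 + m)%N s) (pS (n.+1 + m)%N t).
    suff : w (n.+1 + m).+1 * F (n.+1 + m)%N s <= w (n.+1 + m).+1 * F (n.+1 + m)%N t by lra.
    by apply: ler_wpM2l => //; exact: ltW.
  have := big N; have := p_phi (n.+1 + N)%N t; have := pmono N n.+1 s.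
  by rewrite addnC; lra.
Qed.

Section running_max.
Context (R : realType) (f : R -> R).
Hypothesis cf : continuous f.
Hypothesis f01 : forall t, 0 <= f t <= 1.

Definition running_max t := sup [set f s | s in [set s | s <= t]].

Let hS t : has_sup [set f s | s in [set s | s <= t]].
Proof.
split; first by exists (f t); exists t => //=.
by exists 1 => _ [s _ <-]; case/andP: (f01 s).
Qed.

Lemma running_max_ge s t : s <= t -> f s <= running_max t.
Proof. by move=> st; apply: (sup_upper_bound (hS t)); exists s. Qed.

Lemma running_max_le t c : (forall s, s <= t -> f s <= c) -> running_max t <= c.
Proof.
by move=> fc; apply: ge_sup => [|_ [s st <-]]; [case: (hS t)|exact: fc].
Qed.

Lemma running_max_homo s t : s <= t -> running_max s <= running_max t.
Proof.
move=> st; apply: running_max_le => u us.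
by apply: running_max_ge; exact: le_trans st.
Qed.

Lemma running_max01 t : 0 <= running_max t <= 1.
Proof.
apply/andP; split; last by apply: running_max_le => s _; case/andP: (f01 s).
by apply: le_trans (running_max_ge (lexx t)); case/andP: (f01 t).
Qed.

Lemma running_max_continuous : continuous running_max.
Proof.
move=> t; apply/cvgrPdist_lt => e e0.
have /cvgrPdist_lt/(_ (e / 3) (divr_gt0 e0 (ltr0n _ 3))) := @cf t.
move=> [r /= r0 rP]; exists r => //= u /= tu.
have near_t w : `|t - w| < r -> f t - e / 3 < f w < f t + e / 3.
  by move=> /rP; rewrite /= ltr_norml; lra.
move: tu; rewrite ltr_norml => /andP[tu1 tu2].
rewrite ltr_norml; have [ut|/ltW tu] := leP u t.
- have := running_max_homo ut => uM.
  suff : running_max t <= running_max u + 2 * (e / 3) by lra.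
  apply: running_max_le => w wt; have [wu|/ltW uw] := leP w u.
    by have := running_max_ge wu; lra.
  have := running_max_ge (lexx u).
  have : `|t - w| < r by rewrite ltr_norml; lra.
  have : `|t - u| < r by rewrite ltr_norml; lra.
  by move=> /near_t ? /near_t; lra.
- have := running_max_homo tu => uM.
  suff : running_max u <= running_max t + e / 3 by lra.
  apply: running_max_le => w wu; have [wt|/ltW tw] := leP w t.
    by have := running_max_ge wt; lra.
  have := running_max_ge (lexx t).
  have : `|t - w| < r by rewrite ltr_norml; lra.
  by move=> /near_t; lra.
Qed.

End running_max.

Definition arc (R : realType) (T : topologicalType) (h : R -> T) :=
  continuous h /\
  forall s t, 0 <= s <= 1 -> 0 <= t <= 1 -> h s = h t -> s = t.

Section arcs.
Context (R : realType) (T : topologicalType) (d : T -> T -> R).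
Hypothesis hd : compatible_metric d.

(** For each rational q, the running maximum of the distance from g q, truncated
    at 1 and taken over the parameters after q, is continuous and nondecreasing.
    If g s and g t differ and s < t, some rational q slightly larger than s
    detects it: the function attached to q vanishes at s and not at t. *)
Lemma height_function (g : R -> T) : continuous g ->
  (forall s t u, 0 <= s -> s <= u -> u <= t -> t <= 1 -> g s = g t -> g u = g s) ->
  exists phi : R -> R, [/\ continuous phi, {homo phi : s t / s <= t} &
    forall s t, 0 <= s <= 1 -> 0 <= t <= 1 -> (phi s = phi t <-> g s = g t)].
Proof.
move=> cg mg.
pose q (n : nat) : R := ratr (odflt 0%Q (choice.unpickle n)).
pose f n s := if 0 <= 1 * s + - q n then Num.min 1 (d (g (q n)) (g s)) else 0.
have fE n w : f n w = if q n <= w then Num.min 1 (d (g (q n)) (g w)) else 0.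
  by rewrite /f; congr (if _ then _ else _); apply/idP/idP; lra.
have cf n : continuous (f n).
  apply: (@glue_continuous R R R (fun s => 1 * s + - q n)
    (fun s => Num.min 1 (d (g (q n)) (g s))) (fun=> 0)).
  - exact: affine_continuous.
  - move=> s; apply: (@continuous_min R R (fun=> 1) (fun s => d (g (q n)) (g s))).
      exact: cvg_cst.
    exact: (@continuousT_comp R T R g (d (g (q n))) cg (dist_continuous hd (x := _))).
  - by move=> s; exact: cvg_cst.
  - move=> s h; have -> : s = q n by lra.
    by rewrite (dist_refl hd) min_r.
have f01 n s : 0 <= f n s <= 1.
  rewrite /f; case: ifP => _; last by rewrite lexx ler01.
  by rewrite le_min ge_min lexx ler01 dist_ge0.
pose F n := running_max (f n).
have [phi [cphi mphi sphi]] := weighted_sum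
  (fun n => running_max_continuous (cf n) (f01 n))
  (fun n => running_max01 (f01 n)).
have Fhomo s t : s <= t -> forall n, F n s <= F n t.
  by move=> st n; exact: running_max_homo.
have phi_const s t : 0 <= s -> s <= t -> t <= 1 -> g s = g t -> phi s = phi t.
  move=> s0 st t1 gst; apply/eqP; rewrite eq_le mphi ?mphi//; last exact: Fhomo.
  move=> n; apply: running_max_le => // u ut.
  have [us|/ltW su] := leP u s; first exact: running_max_ge.
  have gu : g u = g s by apply: (mg s t u).
  have := running_max_ge (f01 n) (lexx s).
  have /andP[F0 _] := running_max01 (f01 n) s.
  rewrite !fE gu; have [qs|sq] := leP (q n) s; first by rewrite (le_trans qs su).
  move=> _; case: ifP => // qu; have -> : g (q n) = g s.
    by apply: (mg s t) => //; [exact: ltW|exact: le_trans qu ut].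
  by rewrite (dist_refl hd) min_r.
have phi_lt s t : 0 <= s -> s < t -> t <= 1 -> g s <> g t -> phi s < phi t.
  move=> s0 st t1 gst.
  have /(dist_continuousP hd)/(_ s _ (dist_gt0 hd gst))[r /= r0 rP] := cg.
  have [|p /itvP pP] := @rat_in_itvoo R s (Num.min t (s + r)).
    by rewrite lt_min st; lra.
  have sp : s < ratr p by rewrite pP.
  have : ratr p < Num.min t (s + r) by rewrite pP.
  rewrite lt_min => /andP[pt pr].
  have qE : q (choice.pickle p) = ratr p by rewrite /q choice.pickleK.
  apply: (sphi _ _ (choice.pickle p)); first by apply: Fhomo; exact: ltW.
  apply: (@le_lt_trans _ _ 0).
    apply: running_max_le => // u us.
    by rewrite fE ifF// qE; apply/negbTE; rewrite -ltNge; lra.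
  apply: lt_le_trans (running_max_ge (f01 _) (lexx t)).
  rewrite fE qE (ltW pt).
  rewrite lt_min ltr01; apply: (dist_gt0 hd) => gpt.
  have := rP (ratr p); rewrite /= gpt ltxx => H.
  by suff : false by []; apply: H; rewrite ltr_norml; lra.
have phiP s t : 0 <= s -> s <= t -> t <= 1 -> (phi s = phi t <-> g s = g t).
  move=> s0 st t1; split; last exact: phi_const.
  move=> phist; apply: contrapT => gst.
  have : s < t.
    by rewrite lt_neqAle st andbT; apply/eqP => est; apply: gst; rewrite est.
  by move=> s_lt_t; have := phi_lt _ _ s0 s_lt_t t1 gst; rewrite phist ltxx.
exists phi; split=> //; first by move=> s t st; apply: mphi; exact: Fhomo.
move=> s t /andP[s0 s1] /andP[t0 t1]; have [st|/ltW ts] := leP s t.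
  exact: phiP.
have [H1 H2] := phiP _ _ t0 ts s1.
by split=> /esym; [move/H1|move/H2].
Qed.

(** The path without loops factors through its height function phi, and the
    factor is continuous because phi is a closed map on [0, 1]. *)
Lemma arc_of_path (g : R -> T) : continuous g -> g 0 <> g 1 ->
  exists h : R -> T, [/\ arc h, h 0 = g 0, h 1 = g 1 &
    forall t, 0 <= t <= 1 -> exists2 s, 0 <= s <= 1 & h t = g s].
Proof.
move=> cg0 g01.
have i0 : 0 <= (0 : R) <= 1 by apply/andP.
have i1 : 0 <= (1 : R) <= 1 by apply/andP.
have [g1 [cg g10 g11 img mg]] := loop_erasure hd cg0.
have {}g01 : g1 0 <> g1 1 by rewrite g10 g11.
have [phi [cphi mphi phiP]] := height_function cg mg.
have phi01 : phi 0 < phi 1.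
  rewrite lt_neqAle mphi ?ler01// andbT; apply/eqP => /(phiP _ _ i0 i1).
  exact: g01.
pose clamp (x : R) := Num.max 0 (Num.min x 1).
have clampP x : 0 <= clamp x <= 1.
  by rewrite /clamp le_max lexx/= ge_max ge_min lexx orbT ler01.
have clampE x : 0 <= x <= 1 -> clamp x = x.
  by move=> /andP[x0 x1]; rewrite /clamp (min_idPl x1) (max_idPr x0).
pose v x := (phi 1 - phi 0) * clamp x + phi 0.
have cclamp : continuous clamp.
  move=> x; apply: (@continuous_max R R (fun=> 0) (fun x => Num.min x 1)).
    exact: cvg_cst.
  by apply: (@continuous_min R R id (fun=> 1)); [exact: cvg_id|exact: cvg_cst].
have cv : continuous v.
  by apply: (@continuousT_comp R R R clamp (fun t => _ * t + _) cclamp); exact: affine_continuous.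
have /choice[tau tauP] : forall x, exists s, 0 <= s <= 1 /\ phi s = v x.
  move=> x; have [||s] := @IVT R phi 0 1 (v x) ler01.
  - exact: continuous_subspaceT.
  - have /andP[c0 c1] := clampP x; rewrite (min_idPl (ltW phi01)) (max_idPr (ltW phi01)).
    have dphi : 0 <= phi 1 - phi 0 by rewrite subr_ge0 ltW.
    apply/andP; split; first by rewrite /v lerDr mulr_ge0.
    by rewrite /v -lerBrDr ler_piMr.
  by rewrite in_itv/= => s01 ps; exists s.
have tau01 x : 0 <= tau x <= 1 by have [] := tauP x.
have ptau x : phi (tau x) = v x by have [] := tauP x.
exists (g1 \o tau); split.
- split.
  + apply/(dist_continuousP hd) => x e e0 /=.
    pose K := `[0, 1]%classic `&` [set s | e <= d (g1 (tau x)) (g1 s)].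
    have cdg : continuous (fun s => d (g1 (tau x)) (g1 s)).
      exact: (@continuousT_comp R T R g1 (d (g1 (tau x))) cg (dist_continuous hd (x := _))).
    have cK : compact K.
      apply: compact_closedI; first exact: segment_compact.
      apply: (closed_comp (f := fun s => d (g1 (tau x)) (g1 s))) (@closed_ge _ e).
      by move=> s _; exact: cdg.
    have cphiK : closed (phi @` K).
      apply: compact_closed; first exact: Rhausdorff.
      by apply: continuous_compact => //; exact: continuous_subspaceT.
    have nvx : ~ (phi @` K) (v x).
      move=> [s [/= s01]]; rewrite -ptau => es.
      move=> /(phiP _ _ _ (tau01 x)) gs.
      have {}gs : g1 s = g1 (tau x) by apply: gs; move: s01; rewrite in_itv.
      by move: es; rewrite gs dist_refl//; lra.
    have nv : nbhs x (v @^-1` (~` (phi @` K))).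
      by apply: cv; apply: open_nbhs_nbhs; split=> //; exact: closed_openC.
    apply: filterS nv => y /= nvy.
    rewrite ltNge; apply/negP => es; apply: nvy.
    by exists (tau y) => //; split=> //; rewrite /= in_itv/= tau01.
  + move=> s t s01 t01 /= /(phiP _ _ (tau01 s) (tau01 t)).
    rewrite !ptau /v !clampE// => /addIr/mulfI; apply.
    by rewrite subr_eq0 gt_eqF.
- rewrite /= -g10; apply/(phiP _ _ (tau01 0) i0).
  by rewrite ptau /v clampE// mulr0 add0r.
- rewrite /= -g11; apply/(phiP _ _ (tau01 1) i1).
  by rewrite ptau /v clampE// mulr1 subrK.
- by move=> t _; have [s s01 gs] := img (tau t) (tau01 t); exists s.
Qed.

End arcs.

(** * Subspaces and simple closed curves *)

Section subtypes.
Context (T : topologicalType) (A : set T).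

Definition to_subtype x (Ax : A x) : set_type A := exist _ x (mem_set Ax).

Lemma subtype_valP (x : set_type A) : A (set_val x).
Proof. exact: set_valP. Qed.

Lemma subtype_val_inj (x y : set_type A) : set_val x = set_val y -> x = y.
Proof. exact: val_inj. Qed.

Lemma subtype_val_continuous : continuous (set_val : set_type A -> T).
Proof. exact: initial_continuous. Qed.

Lemma subtype_nbhs (x : set_type A) (U : set (set_type A)) :
  nbhs x U <-> exists2 W, nbhs (set_val x) W & set_val @^-1` W `<=` U.
Proof.
split=> [|[W nW WU]].
  move=> [_ [[W oW <-] Wx WU]]; exists W => //.
  by apply: open_nbhs_nbhs.
by apply: filterS WU _; exact: subtype_val_continuous.
Qed.

Lemma subtype_continuous (S : topologicalType) (f : S -> set_type A) :
  continuous (fun x => set_val (f x)) -> continuous f.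
Proof.
move=> cf x U /subtype_nbhs[W nW WU]; have := cf x W nW.
by rewrite !nbhs_simpl/=; apply: filterS => y /= ?; exact: WU.
Qed.

Lemma subtype_closed (F : set (set_type A)) :
  closed F -> exists2 C, closed C & F = set_val @^-1` C.
Proof.
move=> cF; have [W oW WF] : open (~` F) by exact: closed_openC.
exists (~` W); first exact: open_closedC.
by rewrite -[F]setCK -WF.
Qed.

Lemma subtype_compact : compact A -> compact [set: set_type A].
Proof.
move=> cA F FF _; have GF : ProperFilter (set_val @ F) by exact: fmap_proper_filter.
have FA : F (set_val @^-1` A).
  have -> : set_val @^-1` A = [set: set_type A].
    by apply/seteqP; split => // x _; exact: subtype_valP.
  exact: filterT.
have [p [Ap clp]] := cA (set_val @ F) GF FA.
exists (to_subtype Ap); split=> // U V FU /subtype_nbhs[W nW WV].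
have FU' : F (set_val @^-1` (set_val @` U)).
  by apply: (filterS _ FU) => x Ux; exists x.
have [y [[x Ux <-] Wx]] := clp _ W FU' nW.
by exists x; split=> //; exact: WV.
Qed.

Lemma subtype_preimage_connected (M : set T) : M `<=` A -> connected M ->
  connected (set_val @^-1` M : set (set_type A)).
Proof.
move=> MA cM B [b Bb] [_ [C oC <-] BC] [D' /subtype_closed[D cD ->] BD].
have CM x (Mx : M x) : B (to_subtype (MA _ Mx)) <-> C x.
  by rewrite BC; split=> [[]|].
have DM x (Mx : M x) : B (to_subtype (MA _ Mx)) <-> D x.
  by rewrite BD; split=> [[]|].
have MC : M `&` C = M.
  apply: cM; [|by exists C|exists D => //].
    by exists (set_val b); move: Bb; rewrite BC.
  apply/seteqP; split=> x [Mx] H; split=> //.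
    by apply/(DM _ Mx)/(CM _ Mx).
  by apply/(CM _ Mx)/(DM _ Mx).
rewrite BC; apply/seteqP; split=> [x []//|x /= Mx]; split=> //.
have [_ Cx] : (M `&` C) (set_val x) by rewrite MC.
exact: Cx.
Qed.

Lemma subtype_connected : connected A -> connected [set: set_type A].
Proof.
move=> cA; have -> : [set: set_type A] = set_val @^-1` A.
  by apply/seteqP; split=> // x _; exact: subtype_valP.
exact: subtype_preimage_connected.
Qed.

End subtypes.

Lemma subtype_metric (R : realType) (T : topologicalType) (d : T -> T -> R)
    (A : set T) :
  compatible_metric d ->
  compatible_metric (fun x y : set_type A => d (set_val x) (set_val y)).
Proof.
move=> hd; split.
- by move=> x; exact: dist_refl.
- by move=> x y; exact: dist_sym.
- by move=> y x z; exact: dist_triangle.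
- by move=> x y /(dist_sep hd); exact: subtype_val_inj.
- move=> x U; split=> [/subtype_nbhs[W /(dist_nbhs hd)[e e0 eW] WU]|[e e0 eU]].
    by exists e => // y /eW /WU.
  apply/subtype_nbhs; exists [set y | d (set_val x) y < e]; first exact: nbhs_dball.
  by move=> y /= /eU.
Qed.

(** Conversely a compatible distance makes a space metrizable: [metric_copy] is the
    same set with the topology defined by the distance. *)
Section metric_copy.
Context (R : realType) (T : topologicalType) (d : T -> T -> R).
Hypothesis hd : compatible_metric d.

Definition metric_copy : Type := let _ := hd in T.
HB.instance Definition _ := Choice.copy metric_copy T.
HB.instance Definition _ := @isMetric.Build R metric_copy d
  (dist_refl hd) (dist_sep hd) (dist_sym hd) (dist_triangle hd).

Lemma dist_metrizable : metrizable R T.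
Proof.
exists metric_copy, id, id; split=> //.
- move=> x U; rewrite -metricType_numDomainType.filter_from_mdist_nbhs => -[e /= e0 eU].
  by apply/(dist_nbhs hd); exists e.
- move=> x U /(dist_nbhs hd)[e e0 eU].
  rewrite nbhs_simpl/= -metricType_numDomainType.filter_from_mdist_nbhs.
  by exists e.
Qed.

End metric_copy.

(** Images of closed sets under c are compact, hence closed. *)
Lemma compact_injection_inverse (S T : topologicalType) (c : S -> T)
    (g : set_type (range c) -> S) :
  compact [set: S] -> hausdorff_space T -> continuous c -> injective c ->
  (forall y, c (g y) = set_val y) -> continuous g.
Proof.
move=> cS hT cc ic gP; apply/continuous_closedP => F cF.
have -> : g @^-1` F = set_val @^-1` (c @` F).
  apply/seteqP; split=> y /=; first by move=> Fy; exists (g y); rewrite ?gP.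
  by move=> [x Fx cxy]; have <- : x = g y by apply: ic; rewrite gP.
apply: preimage_closed; first by move=> y _; exact: subtype_val_continuous.
apply: compact_closed => //; apply: continuous_compact.
  exact: continuous_subspaceT.
exact: subclosed_compact cF cS _.
Qed.

Lemma compact_injection_homeomorphic (S T : topologicalType) (c : S -> T) :
  compact [set: S] -> hausdorff_space T -> continuous c -> injective c ->
  homeomorphic S (set_type (range c)).
Proof.
move=> cS hT cc ic.
pose f x : set_type (range c) := to_subtype (imageT c x).
have /choice[g gP] : forall y : set_type (range c), exists x, c x = set_val y.
  by move=> y; have [x _ xy] := subtype_valP y; exists x.
exists f, g; split.
- by move=> x; apply: ic; rewrite gP.
- by move=> y; apply: subtype_val_inj; exact: gP.
- exact: subtype_continuous.
- exact: (compact_injection_inverse cS hT cc ic gP).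
Qed.

Notation circle_type R := (set_type (@circle R)).

Lemma circle_compact (R : realType) : compact (@circle R).
Proof.
have := @subclosed_compact (R * R)%type (@circle R) (`[-1, 1]%classic `*` `[-1, 1]%classic).
apply.
- apply: (closed_comp (f := fun p : R * R => p.1 ^+ 2 + p.2 ^+ 2) _ (@closed_eq R 1)).
  move=> p _; apply: cvgD; apply: cvgM; (exact: cvg_fst || exact: cvg_snd).
- by apply: compact_setX; exact: segment_compact.
- by move=> [x y]; rewrite /circle /= !in_itv/= => h; split; apply/andP; split; nra.
Qed.

Lemma injective_circle_curve (R : realType) (T : topologicalType)
    (c : circle_type R -> T) :
  hausdorff_space T -> continuous c -> injective c ->
  simple_closed_curve R (range c).
Proof.
move=> hT; apply: compact_injection_homeomorphic => //.
exact/subtype_compact/circle_compact.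
Qed.

Lemma simple_closed_curve_param (R : realType) (T : topologicalType) (A : set T) :
  simple_closed_curve R A -> exists c : circle_type R -> T,
    [/\ continuous c, injective c & range c = A].
Proof.
move=> [f [g [fK gK cf cg]]]; exists (set_val \o f); split.
- by move=> x; apply: continuous_comp; [exact: cf|exact: subtype_val_continuous].
- by move=> x y /= /subtype_val_inj /(can_inj fK).
- apply/seteqP; split=> [_ [x _ <-]|x Ax]; first exact: subtype_valP.
  by exists (g (to_subtype Ax)) => //=; rewrite gK.
Qed.

(** * Simple closed curves from arcs *)

(** The upper half of the circle is sent along h and the lower half along g. *)
Lemma theta_curve (R : realType) (T : topologicalType) (h g : R -> T) :
  hausdorff_space T -> arc h -> arc g -> h 0 = g 0 -> h 1 = g 1 ->
  (forall s t, 0 <= s <= 1 -> 0 <= t <= 1 -> h s = g t ->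
    (s = 0 /\ t = 0) \/ (s = 1 /\ t = 1)) ->
  exists A : set T, simple_closed_curve R A.
Proof.
move=> hT [ch ih] [cg ig] hg0 hg1 hg.
pose u (p : circle_type R) : R := 2^-1 * (set_val p).1 + 2^-1.
have circ (p : circle_type R) : (set_val p).1 ^+ 2 + (set_val p).2 ^+ 2 = 1.
  exact: (subtype_valP p).
have cfst : continuous (fun p : circle_type R => (set_val p).1).
  move=> p; apply: continuous_comp; first exact: subtype_val_continuous.
  exact: cvg_fst.
have csnd : continuous (fun p : circle_type R => (set_val p).2).
  move=> p; apply: continuous_comp; first exact: subtype_val_continuous.
  exact: cvg_snd.
have cu : continuous u.
  apply: (@continuousT_comp _ R R (fun p : circle_type R => (set_val p).1)
    (fun t => 2^-1 * t + 2^-1) cfst).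
  exact: affine_continuous.
have u01 p : 0 <= u p <= 1.
  by rewrite /u; have := circ p; set x := _.1; set y := _.2 => ?; apply/andP; split; nra.
pose c p := if 0 <= (set_val p).2 then h (u p) else g (u p).
have cc : continuous c.
  apply: (@glue_continuous R _ T (fun p => (set_val p).2) (h \o u) (g \o u)) => //.
  - exact: (continuousT_comp cu ch).
  - exact: (continuousT_comp cu cg).
  - move=> p p2 /=; have := circ p; rewrite p2 expr0n addr0 /u.
    move/eqP; rewrite sqrf_eq1 => /orP[]/eqP ->.
      by have -> : 2^-1 * 1 + 2^-1 = 1 :> R by field.
    by have -> : 2^-1 * -1 + 2^-1 = 0 :> R by field.
have u_inj p q : u p = u q -> (0 <= (set_val p).2) = (0 <= (set_val q).2) -> p = q.
  move=> upq sg; apply: subtype_val_inj.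
  have p1 : (set_val p).1 = (set_val q).1 by move: upq; rewrite /u; lra.
  have := circ p; have := circ q; rewrite -p1 => {upq}.
  rewrite [set_val p]surjective_pairing [set_val q]surjective_pairing -p1.
  move: sg; set y := (set_val p).2; set z := (set_val q).2 => sg Hq Hp.
  congr pair; have /eqP : y ^+ 2 = z ^+ 2 by lra.
  rewrite eqf_sqr => /orP[/eqP//|/eqP yz]; move: sg Hp Hq; rewrite yz.
  by case: (leP 0 z) => z0; case: (leP 0 (- z)) => // z0'; lra.
have mix p q : 0 <= (set_val p).2 -> (set_val q).2 < 0 -> h (u p) <> g (u q).
  move=> _ q2 /(hg _ _ (u01 p) (u01 q)) H.
  have q1 : (set_val q).1 ^+ 2 = 1.
    have [[_ uq]|[_ uq]] := H; move: uq; rewrite /u => uq.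
      have -> : (set_val q).1 = -1 by lra.
      by rewrite sqrrN expr1n.
    have -> : (set_val q).1 = 1 by lra.
    by rewrite expr1n.
  by have := circ q; rewrite q1; nra.
exists (range c); apply: injective_circle_curve => // p q; rewrite /c.
case: (leP 0 (set_val p).2) => p2; case: (leP 0 (set_val q).2) => q2.
- by move=> /(ih _ _ (u01 p) (u01 q)) /u_inj; apply; rewrite p2 q2.
- by move=> /(mix _ _ p2 q2).
- by move=> /esym /(mix _ _ q2 p2).
- move=> /(ig _ _ (u01 p) (u01 q)) /u_inj; apply.
  by rewrite !leNgt p2 q2.
Qed.

Section curves.
Context (R : realType) (T : topologicalType) (d : T -> T -> R).
Hypothesis hd : compatible_metric d.

Lemma arc_segment_closed (h g : R -> T) a b : continuous h -> continuous g ->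
  open [set t | ~ (h @` `[a, b]%classic) (g t)].
Proof.
move=> ch cg; apply: (@open_comp _ _ g (~` (h @` `[a, b]%classic))).
  by move=> t _; exact: cg.
apply: closed_openC; apply: compact_closed; first exact: dist_hausdorff hd.
by apply: continuous_compact; [exact: continuous_subspaceT|exact: segment_compact].
Qed.

(** Let T1 be the first time at which g meets the part of the arc after s, and T0
    the last time before T1 at which it meets the part before s.  Between T0 and
    T1 the path g stays off the arc and joins points a and b on both sides of s,
    so an arc extracted from it and the subarc from a to b form a simple closed
    curve. *)
Lemma arc_bypass_curve (h g : R -> T) s : arc h -> 0 < s < 1 -> continuous g ->
  g 0 = h 0 -> g 1 = h 1 -> (forall t, g t <> h s) ->
  exists A : set T, simple_closed_curve R A.
Proof.
move=> [ch ih] /andP[s0 s1] cg gh0 gh1 gs.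
have i0 : 0 <= (0 : R) <= 1 by apply/andP.
have i1 : 0 <= (1 : R) <= 1 by apply/andP.
have o1 := @arc_segment_closed h g s 1 ch cg.
have o2 := @arc_segment_closed h g 0 s ch cg.
have [|T1 [T10 /contrapT[b bs hb] T1P]] := right_gap (x := 0) o1.
  exists 1 => //=; apply; exists 1 => //.
  by rewrite /= in_itv/= lexx ltW.
have nT10 : ~ [set t | ~ (h @` `[0, s]%classic) (g t)] 0.
  by apply; exists 0 => //; rewrite /= in_itv/= lexx ltW.
have [|T0 [T01 /contrapT[a as_ ha] T0P]] := left_gap (x := T1) o2.
  by exists 0.
have T00 : 0 <= T0.
  by rewrite leNgt; apply/negP => T00; apply: nT10; apply: T0P; rewrite T00.
have T11 : T1 <= 1.
  rewrite leNgt; apply/negP => T11; apply: (T1P 1); rewrite ?T11 ?ler01//.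
  by exists 1 => //; rewrite /= in_itv/= lexx ltW.
move: as_ bs; rewrite /= !in_itv/= => /andP[a0 as_] /andP[sb b1].
have {}as_ : a < s.
  by rewrite lt_neqAle as_ andbT; apply/eqP => E; apply: (gs T0); rewrite -ha E.
have {}sb : s < b.
  by rewrite lt_neqAle sb andbT; apply/eqP => E; apply: (gs T1); rewrite -hb E.
have ia : 0 <= a <= 1 by rewrite a0 (le_trans (ltW as_))// ltW.
have ib : 0 <= b <= 1 by rewrite b1 andbT (le_trans (ltW s0))// ltW.
have ab : a < b by exact: lt_trans sb.
have out u : T0 < u < T1 -> forall w, 0 <= w <= 1 -> h w <> g u.
  move=> /andP[u0 u1] w /andP[w0 w1] hw; have [ws|/ltW sw] := leP w s.
    by apply: (T0P u); rewrite ?u0 ?ltW//; exists w; rewrite //= in_itv/= w0.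
  apply: (T1P u); first by rewrite u1 andbT (le_trans T00)// ltW.
  by exists w; rewrite //= in_itv/= sw.
pose g' t := g ((T1 - T0) * t + T0).
have cg' : continuous g' by exact: reparametrized_continuous.
have g'0 : g' 0 = h a by rewrite /g' mulr0 add0r.
have g'1 : g' 1 = h b by rewrite /g' mulr1 subrK.
have g'01 : g' 0 <> g' 1.
  rewrite g'0 g'1 => /(ih _ _ ia ib) E.
  by move: ab; rewrite E ltxx.
have [k [[ck ik] k0 k1 kg]] := arc_of_path hd cg' g'01.
pose h' t := h ((b - a) * t + a).
have ch' : continuous h' by exact: reparametrized_continuous.
have h'0 : h' 0 = h a by rewrite /h' mulr0 add0r.
have h'1 : h' 1 = h b by rewrite /h' mulr1 subrK.
have iab (t : R) : 0 <= t <= 1 -> 0 <= (b - a) * t + a <= 1.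
  move=> /andP[t0 t1]; apply/andP; split.
    by rewrite addr_ge0// mulr_ge0// subr_ge0 ltW.
  apply: le_trans b1; rewrite -lerBrDr ler_piMr// subr_ge0; exact: ltW.
have ih' s' t : 0 <= s' <= 1 -> 0 <= t <= 1 -> h' s' = h' t -> s' = t.
  move=> /iab is' /iab it /(ih _ _ is' it) /addIr/mulfI; apply.
  by rewrite subr_eq0 gt_eqF.
apply: (@theta_curve R T h' k (dist_hausdorff hd)) => //.
- by rewrite h'0 k0 g'0.
- by rewrite h'1 k1 g'1.
- move=> s' t is' it E; have [u iu ku] := kg t it.
  have [u0|u0] := eqVneq u 0.
    left; have ka : k t = k 0 by rewrite ku u0 k0.
    split; last exact: ik.
    by apply: ih' => //; rewrite E ka k0 g'0 h'0.
  have [u1|u1] := eqVneq u 1.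
    right; have kb : k t = k 1 by rewrite ku u1 k1.
    split; last exact: ik.
    by apply: ih' => //; rewrite E kb k1 g'1 h'1.
  exfalso; have {iu} /andP[iu0 iu1] := iu.
  have {}u0 : 0 < u by rewrite lt_neqAle eq_sym u0.
  have {}u1 : u < 1 by rewrite lt_neqAle u1.
  have T01' : T0 < T1.
    rewrite lt_neqAle T01 andbT; apply/eqP => ET.
    by apply: g'01; rewrite /g' ET subrr !mul0r.
  apply: (out ((T1 - T0) * u + T0) _ ((b - a) * s' + a)).
  + rewrite ltrDr mulr_gt0 ?subr_gt0//= -ltrBrDr gtr_pMr ?subr_gt0//.
  + exact: iab.
  + by rewrite -/(h' s') E ku.
Qed.

(** Points close to x on an arc from x to z separate x from z, since a path from x
    to z that avoids such a point would produce a simple closed curve. *)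
Lemma separating_points :
  compact [set: T] -> connected [set: T] -> locally_connected T ->
  ~ (exists A : set T, simple_closed_curve R A) ->
  forall (x z : T) (V : set T), x <> z -> nbhs x V -> exists2 y : T, V y &
    y <> x /\ ~ connected_component (~` [set y]) x z.
Proof.
move=> cT coT lc noC x z V xz nV.
have [p [cp p0 p1 _]] : path_in R setT x z.
  exact: (open_connected_path hd cT lc openT coT).
have p01 : p 0 <> p 1 by rewrite p0 p1.
have [h [ah h0 h1 _]] := arc_of_path hd cp p01.
have [ch ih] := ah.
rewrite p0 in h0; rewrite p1 in h1.
have : nbhs (0 : R) (h @^-1` V) by apply: ch; rewrite h0.
move=> [r /= r0 rV].
pose s := Num.min (r / 2) (1 / 2).
have s0 : 0 < s by rewrite lt_min !divr_gt0.
have sr : s < r.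
  have : s <= r / 2 by rewrite ge_min lexx.
  by have := r0; lra.
have s1 : s < 1.
  have : s <= 1 / 2 by rewrite ge_min lexx orbT.
  by lra.
exists (h s).
  by apply: rV; rewrite /= sub0r normrN gtr0_norm.
split.
  rewrite -h0 => /ih E; suff : s = 0 by move=> s0'; move: s0; rewrite s0' ltxx.
  by apply: E; rewrite ?lexx ?ler01// !ltW.
move=> Cz; apply: noC.
have oy : open (~` [set h s]).
  apply: closed_openC; apply: accessible_closed_set1.
  by apply: hausdorff_accessible; exact: dist_hausdorff hd.
have hsx : x <> h s.
  rewrite -h0 => /ih E; suff : 0 = s by move=> s0'; move: s0; rewrite -s0' ltxx.
  by apply: E; rewrite ?lexx ?ler01// !ltW.
have Cx : connected_component (~` [set h s]) x x by exact: connected_component_refl.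
have [g [cg g0 g1 gC]] := open_connected_path hd cT lc
  (open_connected_component x lc oy) (@component_connected _ _ _) Cx Cz.
apply: (@arc_bypass_curve h g s) => //.
- by rewrite s0.
- by rewrite g0 h0.
- by rewrite g1 h1.
- by move=> t E; have := connected_component_sub (gC t); rewrite E; exact.
Qed.

End curves.

(** * Fixed points of dendrites *)

Lemma closed_under_cluster (T : topologicalType) (F : set_system T) (S K : set T) x :
  F S -> S `<=` K -> closed K -> cluster F x -> K x.
Proof.
move=> FS SK cK clx; apply: cK => U nU.
by have [y [Sy Uy]] := clx _ _ FS nU; exists y; split=> //; exact: SK.
Qed.

Section fixed_point.
Context (R : realType) (T : topologicalType) (d : T -> T -> R).
Hypothesis hd : compatible_metric d.
Hypothesis cT : compact [set: T].
Hypothesis coT : connected [set: T].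
Hypothesis lc : locally_connected T.
Hypothesis sep : forall (x z : T) (V : set T), x <> z -> nbhs x V ->
  exists2 y : T, V y & y <> x /\ ~ connected_component (~` [set y]) x z.
Variable f : T -> T.
Hypothesis cf : continuous f.
Hypothesis nofix : forall x, f x <> x.

(** [C x] is the side of x towards which f moves x. *)
Let C x := connected_component (~` [set x]) (f x).
Let K x := C x `|` [set x].

Let open_punctured x : open (~` [set x] : set T).
Proof.
apply: closed_openC; apply: accessible_closed_set1.
by apply: hausdorff_accessible; exact: dist_hausdorff hd.
Qed.

Let fC x : C x (f x).
Proof. by apply: connected_component_refl; exact: nofix. Qed.

Let nC x : ~ C x x.
Proof. by move=> /connected_component_sub; exact. Qed.

Let oC x : open (C x).
Proof. exact: open_connected_component. Qed.

Let coC x : connected (C x).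
Proof. exact: component_connected. Qed.

Let subC (x : T) (Q : set T) y : connected Q -> Q y -> C x y -> ~ Q x -> Q `<=` C x.
Proof.
move=> cQ Qy Cy nQx; rewrite /C (same_connected_component Cy).
by apply: connected_component_max => // z Qz /= zx; apply: nQx; rewrite -zx.
Qed.

Let closedK x : closed (K x).
Proof.
rewrite -[K x]setCK; apply: open_closedC; rewrite openE => y /= nKy.
have yx : y <> x by move=> yx; apply: nKy; right.
have oCy := open_connected_component y lc (open_punctured x).
have Cy : connected_component (~` [set x]) y y by exact: connected_component_refl.
apply: filterS (open_nbhs_nbhs (conj oCy Cy)) => z Cz [Kz|/= zx].
  apply: nKy; left; apply: connected_component_trans Kz _.
  exact: connected_component_sym.
by have := connected_component_sub Cz; rewrite zx; exact.
Qed.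

(** If x were not in the closure of [C x], then [C x] would be open and closed. *)
Let connectedK x : connected (K x).
Proof.
have clx : closure (C x) x.
  apply: contrapT => nclx.
  suff CT : C x = setT by apply: (@nC x); rewrite CT.
  apply: coT; first by exists (f x).
    by exists (C x); rewrite ?setTI.
  exists (C x); rewrite ?setTI// => y cy.
  have [Cy//|yx] : K x y.
    by apply: (@closedK x); apply: closureS cy; move=> w; left.
  by exfalso; apply: nclx; move: cy; rewrite yx.
suff -> : K x = closure (C x) by apply: connected_closure.
apply/seteqP; split=> [y [Cy|->//]|]; first exact: subset_closure.
rewrite closureE => y; apply; split; first exact: closedK.
by move=> z; left.
Qed.

(** Going strictly up in this order removes at least the point x from K x. *)
Let below (x y : T) := `[< x = y \/ K y `<=` C x >].

Let CK x : C x `<=` K x. Proof. by move=> y; left. Qed.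

Let below_trans x y z : below x y -> below y z -> below x z.
Proof.
move=> /asboolP[->//|xy] /asboolP[<-|yz]; apply/asboolP; right => //.
by apply: subset_trans yz _; apply: subset_trans xy; exact: CK.
Qed.

Let below_anti x y : below x y -> below y x -> x = y.
Proof.
move=> /asboolP[//|xy] /asboolP[//|yx]; exfalso; apply: (@nC x).
by apply: xy; left; apply: yx; right.
Qed.

(** A cluster point x of the chain is an upper bound.  Both x and f x lie in C a for
    all members a.  If C x contained such an a, then a and f x would be joined in
    C x by a compact connected set Q; a member c of the chain close to x misses
    Q, so Q lies in C c, which contradicts that a is not in C c. *)
Let below_chain (x0 : T) (A : set T) : total_on A below ->
  exists t, forall s, A s -> below s t.
Proof.
move=> tA; have [[m Am mP]|nomax] := pselect (exists2 m, A m & forall s, A s -> below s m).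
  by exists m.
have [A0|/nonemptyPn A0] := pselect (A !=set0); last first.
  by exists x0 => s; rewrite A0.
have above a : A a -> exists2 b, A b & K b `<=` C a.
  move=> Aa; apply: contrapT => nb; apply: nomax; exists a => // s As.
  have [/asboolP[->|]|//] := tA _ _ Aa As; first by apply/asboolP; left.
  by move=> Ks; exfalso; apply: nb; exists s.
pose F := filter_from A (fun a => [set b | A b /\ below a b]).
have FF : ProperFilter F.
  apply: filter_from_proper.
    apply: filter_from_filter => // a b Aa Ab.
    have [ab|ba] := tA _ _ Aa Ab.
      by exists b => // c [Ac bc]; split; split=> //; exact: below_trans bc.
    by exists a => // c [Ac bc]; split; split=> //; exact: below_trans bc.
  by move=> a Aa; exists a; split=> //; apply/asboolP; left.
have [x [_ clx]] := cT FF filterT.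
have Kbelow a b : below a b -> K b `<=` K a.
  by move=> /asboolP[->//|ab]; apply: subset_trans ab _; exact: CK.
have tail a : A a -> F [set b | A b /\ below a b] by move=> Aa; exists a.
have xC a : A a -> C a x.
  move=> /above[b Ab ab]; apply: ab.
  apply: closed_under_cluster (tail _ Ab) _ (@closedK b) clx.
  by move=> c [_ /Kbelow]; apply; right.
have fxC a : A a -> C a (f x).
  move=> /above[b Ab ab]; apply: ab.
  have cpre : closed (f @^-1` (K b)).
    by apply: preimage_closed => [y _|]; [exact: cf|exact: closedK].
  apply: (closed_under_cluster (tail _ Ab) _ cpre clx).
  by move=> c [_ /Kbelow]; apply; left.
exists x => a Aa; apply/asboolP; right.
suff CC : C x `<=` C a by move=> y [/CC//|->]; exact: xC.
apply: (subC (y := f x)) => //; first exact: fxC.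
move=> Cxa.
have [p [cp p0 p1 pC]] := open_connected_path hd cT lc (@oC x) (@coC x) Cxa (fC x).
pose Q := p @` `[0, 1]%classic.
have coQ : connected Q.
  apply: connected_continuous_connected; first exact: segment_connected.
  exact: continuous_subspaceT.
have cQ : closed Q.
  apply: compact_closed; first exact: dist_hausdorff hd.
  by apply: continuous_compact; [exact: continuous_subspaceT|exact: segment_compact].
have Qa : Q a by exists 0; rewrite /= ?in_itv/= ?lexx ?ler01.
have Qf : Q (f x) by exists 1; rewrite /= ?in_itv/= ?lexx ?ler01.
have nQx : (~` Q) x by move=> [t _ ptx]; apply: (@nC x); have := pC t; rewrite ptx.
have nQ : nbhs x (~` Q) by apply: open_nbhs_nbhs; split=> //; exact: closed_openC.
have [b Ab ab] := above _ Aa.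
have [c [[Ac bc] nQc]] := clx _ _ (tail _ Ab) nQ.
have QC : Q `<=` C c by apply: subC coQ Qf (fxC _ Ac) nQc.
by apply: (@nC a); apply: ab; apply: (Kbelow _ _ bc); left; exact: QC.
Qed.

(** Let m be maximal, and y a point close to m that separates m from f m.  As f y
    is close to f m, the set C y contains f m and not m; thus K y lies in C m, and
    y is strictly above m. *)
Lemma fixed_point_free_absurd (x0 : T) : False.
Proof.
have [| | | |m mP] := @Zorn T below.
- by move=> t; apply/asboolP; left.
- by move=> r s t; exact: below_trans.
- exact: below_anti.
- exact: below_chain.
have mfm : m <> f m by move=> /esym /nofix.
have e0 : 0 < d m (f m) / 2 by rewrite divr_gt0// (dist_gt0 hd).
have [O [oO Of cO OB]] := lc (nbhs_dball hd (f m) e0).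
have nV : nbhs m ([set y | d m y < d m (f m) / 2] `&` f @^-1` O).
  apply: filterI; first exact: nbhs_dball.
  by apply: cf; exact: open_nbhs_nbhs.
have [y [/= my Ofy] [ym nmy]] := sep mfm nV.
have nOy : ~ O y.
  move=> /OB /= fy; have := dist_triangle hd y m (f m).
  by rewrite (dist_sym hd y (f m)); lra.
have Cyfm : C y (f m).
  by exists O => //; split=> // z Oz /= zy; apply: nOy; rewrite -zy.
have nKm : ~ K y m.
  move=> [Cym|/esym//]; apply: nmy; apply: connected_component_trans Cyfm.
  exact: connected_component_sym.
have /mP : below m y.
  by apply/asboolP; right; apply: (subC (y := f m)) => //; left.
exact: ym.
Qed.

End fixed_point.

Lemma separated_points_FPP (R : realType) (T : topologicalType)
    (d : T -> T -> R) (hd : compatible_metric d) :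
  [set: T] !=set0 ->
  compact [set: T] -> connected [set: T] -> locally_connected T ->
  (forall (x z : T) (V : set T), x <> z -> nbhs x V ->
    exists2 y : T, V y & y <> x /\ ~ connected_component (~` [set y]) x z) ->
  FPP T.
Proof.
move=> [x0 _] cT coT lc sep f cf; apply: contrapT => nf.
apply: (fixed_point_free_absurd hd cT coT lc sep cf _ x0) => x fx.
by apply: nf; exists x.
Qed.

Lemma dendrite_FPP (R : realType) (T : topologicalType) : dendrite R T -> FPP T.
Proof.
move=> [[T0 cT coT /metrizable_dist[d hd]] lc noC].
apply: (separated_points_FPP hd) => //.
exact: (separating_points hd).
Qed.

(** * Small neighbourhoods with locally connected closure *)

Lemma star_connected (T : topologicalType) (S : set T) p :
  (forall y, S y -> exists M, [/\ connected M, M p, M y & M `<=` S]) ->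
  connected S.
Proof.
move=> H; suff -> : S = connected_component S p by exact: component_connected.
apply/seteqP; split; last exact: connected_component_sub.
by move=> y /H[M [cM Mp My MS]]; exists M.
Qed.

Lemma closure_bigcup_fset (T : topologicalType) (I : choiceType) (D : {fset I})
    (S : I -> set T) y :
  closure (\bigcup_(j in [set` D]) S j) y -> exists2 j, j \in D & closure (S j) y.
Proof.
move=> cy; apply: contrapT => nex.
have nD : nbhs y (\bigcap_(j in [set` D]) ~` closure (S j)).
  apply: filter_bigI => j jD; apply: open_nbhs_nbhs; split.
    exact/closed_openC/closed_closure.
  by move=> cj; apply: nex; exists j.
have [z [[j /= jD Sz] nz]] := cy _ nD.
by apply: (nz j jD); exact: subset_closure.
Qed.

Lemma compact_fset_cover (T : topologicalType) (V : T -> set T) :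
  compact [set: T] -> (forall x, nbhs x (V x)) ->
  exists D : {fset T}, forall y, exists2 j, j \in D & V j y.
Proof.
move=> cT nV.
pose F := filter_from setT (fun D : {fset T} => [set D' | (D `<=` D')%fset]).
have FF : Filter F.
  apply: filter_from_filter; first by exists fset0.
  move=> D1 D2 _ _; exists (D1 `|` D2)%fset => // D' sD'.
  by split; apply: fsubset_trans sD'; [exact: fsubsetUl|exact: fsubsetUr].
have /compact_near_coveringP := cT.
move=> /(_ _ F (fun D y => exists2 j, j \in D & V j y) FF) near_F.
have [x _|D _ HD] := near_F _; last first.
  by exists D => y; exact: (HD D (fsubset_refl D) y I).
exists (V x, [set D' | ([fset x] `<=` D')%fset]) => /=.
  by split; [exact: nV|exists [fset x]%fset].
move=> [y D'] [/= Vy xD']; exists x => //.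
by apply: (fsubsetP xD'); rewrite inE.
Qed.

Section property_S.
Context (R : realType) (T : topologicalType) (d : T -> T -> R).
Hypothesis hd : compatible_metric d.
Hypothesis cT : compact [set: T].
Hypothesis lc : locally_connected T.
Variable e : R.
Hypothesis e0 : 0 < e.

Let r k : R := e / 2 ^+ k.
Let r0 k : 0 < r k.
Proof. by rewrite divr_gt0// exprn_gt0. Qed.
Let rS k : r k = r k.+1 + r k.+1.
Proof. by rewrite /r exprS invfM; lra. Qed.

Definition smaller (s : R) (L : set T) := forall u v, L u -> L v -> d u v < s.

(** The points reached from A by chains of n connected sets of diameters less than
    r k, r (k + 1), ...  As these diameters form a convergent series, the sets
    reached from a point remain small, and late links only add small pieces to
    what early links have reached. *)
Fixpoint grow (A : set T) k n : set T :=
  if n is m.+1 then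
    [set y | exists L, [/\ connected L, smaller (r (k + m)) L, L y &
      L `&` grow A k m !=set0]]
  else A.

Lemma grow_sub A B k n : A `<=` B -> grow A k n `<=` grow B k n.
Proof.
move=> AB; elim: n => [//|n IH] y /= [L [cL sL Ly [z [Lz Az]]]].
by exists L; split=> //; exists z; split=> //; exact: IH.
Qed.

Lemma growS A k n : grow A k n `<=` grow A k n.+1.
Proof.
move=> y Ay; exists [set y]; split=> //; last by exists y.
  exact: connected1.
by move=> u v /= -> ->; rewrite (dist_refl hd).
Qed.

Lemma grow_le A k m n : (m <= n)%N -> grow A k m `<=` grow A k n.
Proof.
move=> mn; rewrite -(subnKC mn); elim: (n - m)%N => [|j IH]; first by rewrite addn0.
by rewrite addnS; apply: subset_trans IH _; exact: growS.
Qed.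

Lemma growD A k m n : grow A k (m + n) = grow (grow A k m) (k + m) n.
Proof. by elim: n => [|n IH]; rewrite ?addn0// addnS/= IH addnA. Qed.

Lemma grow_point A k n y : grow A k n y -> exists2 a, A a & grow [set a] k n y.
Proof.
elim: n y => [|n IH] y /=; first by exists y.
move=> [L [cL sL Ly [z [Lz /IH[a Aa az]]]]].
by exists a => //; exists L; split=> //; exists z.
Qed.

Lemma grow_dist a k n y : grow [set a] k n y -> d a y <= 2 * r k - 2 * r (k + n).
Proof.
elim: n y => [|n IH] y /=; first by move=> ->; rewrite addn0 (dist_refl hd) subrr.
move=> [L [cL sL Ly [z [Lz /IH az]]]].
have := sL _ _ Lz Ly; have := dist_triangle hd z a y.
by rewrite addnS; have := rS (k + n); lra.
Qed.

Lemma grow_connected a k n : connected (grow [set a] k n).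
Proof.
elim: n => [|n IH]; first exact: connected1.
have ga : grow [set a] k n a by apply: (@grow_le _ _ 0).
apply: (@star_connected _ _ a) => y [L [cL sL Ly [z [Lz gz]]]].
exists (grow [set a] k n `|` L); split.
- by apply: connectedU => //; exists z.
- by left.
- by right.
- move=> w [/growS//|Lw]; exists L; split=> //.
  by exists z.
Qed.

Lemma small_connected_nbhd x s : 0 < s ->
  exists V, [/\ open V, V x, connected V & smaller s V].
Proof.
move=> s0; have s20 : 0 < s / 2 by rewrite divr_gt0.
have [V [oV Vx cV VB]] := lc (nbhs_dball hd x s20).
exists V; split=> // u v /VB /= xu /VB /= xv.
by have := dist_triangle hd x u v; rewrite (dist_sym hd u x); lra.
Qed.

Variable p : T.
Definition chain_ball : set T := [set y | exists n, grow [set p] 0 n y].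

Lemma chain_ball_center : chain_ball p.
Proof. by exists 0%N. Qed.

Lemma chain_ball_open : open chain_ball.
Proof.
rewrite openE => y [n gy].
have [V [oV Vy cV sV]] := small_connected_nbhd y (r0 n).
apply: filterS (open_nbhs_nbhs (conj oV Vy)) => z Vz.
by exists n.+1, V; split=> //; exists y.
Qed.

Lemma chain_ball_connected : connected chain_ball.
Proof.
apply: (@star_connected _ _ p) => y [n gy]; exists (grow [set p] 0 n).
split=> //; first exact: grow_connected.
  by apply: (@grow_le _ _ 0).
by move=> z gz; exists n.
Qed.

Lemma chain_ball_dist y : chain_ball y -> d p y <= 2 * e.
Proof.
move=> [n /grow_dist]; have := r0 (0 + n)%N.
have -> : r 0 = e by rewrite /r expr0 divr1.
by lra.
Qed.

(** Property S: the ball is a finite union of connected sets of diameter less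
    than s.  Cover the space by finitely many small connected open sets V j; the
    points reached after k links in V j, together with everything reached from
    them later, form a connected set because the next link can be V j itself. *)
Lemma chain_ball_property_S s : 0 < s ->
  exists (D : {fset T}) (S : T -> set T),
    [/\ chain_ball = \bigcup_(j in [set` D]) S j,
        forall j, connected (S j) & forall j, smaller s (S j)].
Proof.
(* a piece has diameter at most r k + 4 * r k: a point of it is at distance at
   most 2 * r k from V j *)
move=> s0; have [k ks] := geometric_lt e (divr_gt0 s0 (ltr0n _ 5)).
rewrite -/(r k) in ks.
have /choice[V VP] : forall x, exists V, [/\ open V, V x, connected V & smaller (r k) V].
  by move=> x; exact: small_connected_nbhd.
have [|D DV] := compact_fset_cover (V := V) cT.
  by move=> x; have [oV Vx _ _] := VP x; exact: open_nbhs_nbhs.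
pose A j := V j `&` grow [set p] 0 k.
pose S j := [set y | exists n, grow (A j) k n y].
exists D, S; split.
- apply/seteqP; split=> y.
    move=> [n gy].
    have {}gy : grow [set p] 0 (k + n) y by apply: grow_le gy; exact: leq_addl.
    rewrite growD add0n in gy; have [a ga gay] := grow_point gy.
    have [j jD Vja] := DV a.
    by exists j => //; exists n; apply: grow_sub gay => _ ->.
  move=> [j _ [n gy]]; exists (k + n)%N; rewrite growD add0n.
  by apply: grow_sub gy; move=> z [].
- move=> j; have [[a0 Aa0]|/nonemptyPn A0] := pselect (A j !=set0); last first.
    suff -> : S j = set0 by exact: connected0.
    by apply/seteqP; split=> // y [n /grow_point[a]]; rewrite A0.
  have [_ _ cV sV] := VP j.
  have VS : V j `<=` grow (A j) k 1.
    move=> y Vy; exists (V j); split=> //; first by rewrite addn0.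
    by exists a0; split=> //; case: Aa0.
  apply: (@star_connected _ _ a0) => y [n gy].
  have [a Aa gay] := grow_point gy.
  exists (V j `|` grow [set a] k n); split.
  + apply: connectedU => //; last exact: grow_connected.
    by exists a; split; [case: Aa|apply: (@grow_le _ _ 0)].
  + by left; case: Aa0.
  + by right.
  + move=> z [/VS gz|gz]; first by exists 1%N.
    by exists n; apply: grow_sub gz => _ ->.
- move=> j u v [n /grow_point[a [Va _] /grow_dist au]] [m /grow_point[b [Vb _] /grow_dist bv]].
  have [_ _ _ sV] := VP j.
  have := dist_triangle hd a u v; have := dist_triangle hd b a v.
  rewrite (dist_sym hd u a); have := sV _ _ Va Vb.
  have := r0 (k + n); have := r0 (k + m).
  by lra.
Qed.

End property_S.

(** If x is in the closure, the union of the closures of those pieces whose closure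
    contains x is connected and small, and it is a neighbourhood of x because the
    closures of the finitely many remaining pieces miss x. *)
Lemma closure_property_S (R : realType) (T : topologicalType) (d : T -> T -> R)
    (hd : compatible_metric d) (B : set T) :
  (forall s : R, 0 < s -> exists (D : {fset T}) (S : T -> set T),
    [/\ B = \bigcup_(j in [set` D]) S j,
        forall j, connected (S j) & forall j, smaller d s (S j)]) ->
  locally_connected (set_type (closure B)).
Proof.
move=> HB; apply: locally_connected_weak => x U.
move=> /subtype_nbhs[W /(dist_nbhs hd)[e e0 eW] WU].
have [D [S [BE cS sS]]] := HB _ (divr_gt0 e0 (ltr0n _ 3)).
have clS j : j \in D -> closure (S j) `<=` closure B.
  by move=> jD; apply: closureS => y Sy; rewrite BE; exists j.
pose M := \bigcup_(j in [set j | j \in D /\ closure (S j) (set_val x)]) closure (S j).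
have MB : M `<=` closure B by move=> y [j [jD _]]; exact: clS.
exists (set_val @^-1` M); split.
- apply/subtype_nbhs.
  exists (\bigcap_(j in [set` D]) [set y | ~ closure (S j) (set_val x) -> ~ closure (S j) y]).
    apply: filter_bigI => j jD; have [cj|ncj] := pselect (closure (S j) (set_val x)).
      by apply: filterS filterT => y _ /(_ cj).
    have : nbhs (set_val x) (~` closure (S j)).
      by apply: open_nbhs_nbhs; split=> //; exact/closed_openC/closed_closure.
    by apply: filterS => y ncy _.
  move=> y /= Wy; have := subtype_valP y; rewrite {1}BE => /closure_bigcup_fset[j jD cy].
  exists j => //; split=> //; apply: contrapT => ncx.
  exact: (Wy j jD ncx cy).
- apply: subtype_preimage_connected => //.
  apply: (@star_connected _ _ (set_val x)) => y [j [jD cjx] cjy].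
  exists (closure (S j)); split=> //; first exact: connected_closure.
  by move=> z cz; exists j.
- move=> y [j [jD /(dist_closureP hd) cjx] /(dist_closureP hd) cjy].
  apply: WU; apply: eW => /=.
  have [u Su xu] := cjx _ (divr_gt0 e0 (ltr0n _ 3)).
  have [v Sv yv] := cjy _ (divr_gt0 e0 (ltr0n _ 3)).
  have := sS _ _ _ Su Sv.
  have := dist_triangle hd u (set_val x) (set_val y).
  have := dist_triangle hd v u (set_val y); rewrite (dist_sym hd v).
  by lra.
Qed.

Lemma locally_connected_closure_nbhd (R : realType) (T : topologicalType)
    (d : T -> T -> R) (hd : compatible_metric d) (x : T) (U : set T) :
  compact [set: T] -> locally_connected T -> nbhs x U ->
  exists B : set T, [/\ open B, B x, connected B, closure B `<=` U &
    locally_connected (set_type (closure B))].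
Proof.
move=> cT lc /(dist_nbhs hd)[e e0 eU].
(* the chain ball with parameter e / 5 has radius 2 * e / 5 *)
have e50 : 0 < e / 5 by rewrite divr_gt0.
exists (chain_ball d (e / 5) x); split.
- exact: chain_ball_open.
- exact: chain_ball_center.
- exact: chain_ball_connected.
- move=> y /(dist_closureP hd)/(_ _ e50)[z /(chain_ball_dist hd e50) xz yz].
  by apply: eU; have := dist_triangle hd z x y; rewrite (dist_sym hd z); lra.
- apply: (closure_property_S hd) => s s0.
  exact: chain_ball_property_S.
Qed.

(** * Extension of circle-valued maps on one-dimensional spaces *)

(** Take a refinement in which no point lies in more than n + 1 members, and assign
    each member to one set of the cover that contains it.  A point in all n + 2
    unions of assigned members would lie in n + 2 different members. *)
Lemma covering_dim_shrink (T : topologicalType) n (U : 'I_n.+2 -> set T) :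
  covering_dim_le T n -> (forall i, open (U i)) -> (forall x, exists i, U i x) ->
  exists W : 'I_n.+2 -> set T,
    [/\ forall i, open (W i), forall i, W i `<=` U i,
        forall x, exists i, W i x & forall x, exists i, ~ W i x].
Proof.
move=> dimT oU cU.
have [||D [_ [oD cD] DU ordD]] := dimT (range U).
- exact/finite_image/finite_finset.
- split; first by move=> _ [i _ <-].
  apply/seteqP; split=> // x _; have [i Ui] := cU x.
  by exists (U i).
have /choice[idx idxP] : forall V : set T, exists i, D V -> V `<=` U i.
  move=> V; have [DV|nDV] := pselect (D V); last by exists ord0.
  by have [_ [i _ <-] VU] := DU _ DV; exists i.
exists (fun i => \bigcup_(V in [set V | D V /\ idx V = i]) V); split.
- by move=> i; apply: bigcup_open => V [/oD].
- by move=> i x [V [DV <-] Vx]; exact: (idxP V DV).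
- move=> x; have [V DV Vx] : (\bigcup_(V in D) V) x by rewrite cD.
  by exists (idx V), V.
- move=> x; apply: contrapT => /forallNP allW.
  have /choice[V VP] : forall i : 'I_n.+2, exists V, [/\ D V, idx V = i & V x].
    by move=> i; have /contrapT[V [DV Vi] Vx] := allW i; exists V.
  pose g (k : nat) := V (inord k).
  have g_inj : {in `I_n.+2 &, injective g}.
    move=> i j /set_mem/= ilt /set_mem/= jlt gij.
    have [_ Vi _] := VP (inord i); have [_ Vj _] := VP (inord j).
    have : inord i = inord j :> 'I_n.+2 by rewrite -Vi -Vj; congr idx; exact: gij.
    by move=> /(congr1 val); rewrite /= !inordK.
  have : (`I_n.+2 #<= `I_n.+1)%card.
    apply: card_le_trans (ordD x); rewrite -(card_le_eql (inj_card_eq g_inj)).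
    apply: subset_card_le => _ [i _ <-].
    by have [DV _ Vx] := VP (inord i).
  by rewrite card_le_II ltnn.
Qed.

(** The distance to the complement, truncated at 1 so that it is finite when W is
    the whole space. *)
Lemma bump_function (R : realType) (T : topologicalType) (d : T -> T -> R)
    (hd : compatible_metric d) (W : set T) : open W ->
  exists phi : T -> R, [/\ continuous phi, forall x, 0 <= phi x &
    forall x, 0 < phi x <-> W x].
Proof.
move=> oW.
pose E x := [set d x y | y in ~` W] `|` [set 1].
have E0 x : E x !=set0 by exists 1; right.
have E_ge0 x : lbound (E x) 0.
  by move=> _ [[y _ <-]|->]; [exact: dist_ge0|exact: ler01].
have hE x : has_inf (E x) by split=> //; exists 0.
pose phi x := inf (E x).
have phi_le x v : E x v -> phi x <= v by move=> Ev; apply: (ge_inf (proj2 (hE x))).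
have phi_ge x c : lbound (E x) c -> c <= phi x by apply: lb_le_inf.
have phi_tri x y : phi x <= phi y + d x y.
  rewrite -lerBlDr; apply: phi_ge => _ [[z nWz <-]|->].
    rewrite lerBlDr; apply: (@le_trans _ _ (d x z)).
      by apply: phi_le; left; exists z.
    by rewrite addrC; exact: dist_triangle.
  rewrite lerBlDr; apply: (@le_trans _ _ 1); first by apply: phi_le; right.
  by rewrite lerDl (dist_ge0 hd).
exists phi; split.
- apply: (lipschitz_continuous hd) => x y; rewrite ler_norml.
  by have := phi_tri x y; have := phi_tri y x; rewrite (dist_sym hd y x); lra.
- by move=> x; exact: phi_ge.
- move=> x; split=> [phi0|Wx].
    apply: contrapT => nWx; have : phi x <= d x x by apply: phi_le; left; exists x.
    by rewrite (dist_refl hd); lra.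
  have /(dist_nbhs hd)[e e0 eW] := open_nbhs_nbhs (conj oW Wx).
  apply: (@lt_le_trans _ _ (Num.min e 1)); first by rewrite lt_min e0 ltr01.
  apply: phi_ge => _ [[y nWy <-]|->]; rewrite ge_min ?lexx ?orbT//.
  by apply/orP; left; rewrite leNgt; apply/negP => /eW.
Qed.

(** Here t is the tangent of half the argument of a + i b. *)
Lemma half_angle (R : realType) (s a b : R) : 0 < s -> a ^+ 2 + b ^+ 2 = s ^+ 2 ->
  0 < s + a -> let t := b / (s + a) in
  (1 - t ^+ 2) / (1 + t ^+ 2) = a / s /\ (2 * t) / (1 + t ^+ 2) = b / s.
Proof.
move=> s0 abs sa t.
have tE : t * (s + a) = b by rewrite /t divfK// gt_eqF.
have t0 : 0 < 1 + t ^+ 2 by have := sqr_ge0 t; lra.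
have sa0 : s + a != 0 by rewrite gt_eqF.
have ht : (s + a) ^+ 2 * (1 + t ^+ 2) = 2 * s * (s + a).
  by rewrite mulrDr mulr1 -exprMn [(_ + _) * t]mulrC tE; nra.
have ht' : (s + a) ^+ 2 * (1 - t ^+ 2) = 2 * a * (s + a).
  by rewrite mulrBr mulr1 -exprMn [(_ + _) * t]mulrC tE; nra.
have tn0 : 1 + t ^+ 2 != 0 by rewrite gt_eqF.
have sn0 : s != 0 by rewrite gt_eqF.
split; apply/eqP; rewrite eqr_div//; apply/eqP.
  apply: (mulfI (expf_neq0 2 sa0)); transitivity (2 * a * (s + a) * s).
    by rewrite mulrA ht'.
  by rewrite mulrCA ht; ring.
apply: (mulfI (expf_neq0 2 sa0)); transitivity (b * (2 * s * (s + a))).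
  by rewrite -tE; ring.
by rewrite -ht; ring.
Qed.

(** In the plane of triples of sum 0, suppose that - l (x, y, z) lies in the cone
    generated by (2, -1, -1) and (-1, 2, -1).  Then z is the largest coordinate;
    if moreover x and y are bounded below as assumed, then all three coordinates
    are small. *)
Lemma opposite_cone_small (R : realType) (x y z p q l : R) :
  x + y + z = 0 -> 0 <= p -> 0 <= q -> 0 < p + q -> 0 < l ->
  2 * p - q = - l * x -> 2 * q - p = - l * y ->
  (0 < p -> - (1 / 4) < x) -> (0 < q -> - (1 / 4) < y) ->
  [/\ - (1 / 2) < x < 1 / 2, - (1 / 2) < y < 1 / 2 & - (1 / 2) < z < 1 / 2].
Proof.
move=> xyz p0 q0 pq l0 hp hq hx hy.
have lz : l * z = p + q.
  have -> : z = - x - y by lra.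
  by lra.
have z0 : 0 < z by rewrite -(pmulr_rgt0 _ l0) lz.
have [{}p0|p0'] := ltP 0 p; have [{}q0|q0'] := ltP 0 q.
- have {}hx := hx p0; have {}hy := hy q0.
  have xz : 0 < z - x by rewrite -(pmulr_rgt0 _ l0) mulrBr lz; lra.
  have yz : 0 < z - y by rewrite -(pmulr_rgt0 _ l0) mulrBr lz; lra.
  by split; lra.
- have {}hx := hx p0.
  have yz : 0 = z - y.
    apply: (mulfI (lt0r_neq0 l0)); rewrite mulr0 mulrBr lz; lra.
  by split; lra.
- have {}hy := hy q0.
  have xz : 0 = z - x.
    apply: (mulfI (lt0r_neq0 l0)); rewrite mulr0 mulrBr lz; lra.
  by split; lra.
- by exfalso; lra.
Qed.

(** The point G = p0 (2, -1, -1) + p1 (-1, 2, -1) + p2 (-1, -1, 2) is a positive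
    combination of at most two of the three generators.  The bounds on the
    coordinates of a point (a, b, - a - b) of the unit circle keep G from pointing
    in the opposite direction. *)
Lemma cone_avoids_opposite (R : realType) (a b p0 p1 p2 l : R) :
  a ^+ 2 + b ^+ 2 = 1 -> 0 <= p0 -> 0 <= p1 -> 0 <= p2 -> 0 < p0 + p1 + p2 ->
  p0 = 0 \/ p1 = 0 \/ p2 = 0 ->
  (0 < p0 -> - (1 / 4) < a) -> (0 < p1 -> - (1 / 4) < b) ->
  (0 < p2 -> - (1 / 4) < - a - b) -> 0 < l ->
  2 * p0 - p1 - p2 = - l * a -> 2 * p1 - p0 - p2 = - l * b -> False.
Proof.
move=> ab h0 h1 h2 hs hz ha hb hc l0 e0 e1.
suff [? ?] : - (1 / 2) < a < 1 / 2 /\ - (1 / 2) < b < 1 / 2 by nra.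
have e2 : 2 * p2 - p0 - p1 = - l * (- a - b) by lra.
have [z|[z|z]] := hz; rewrite z in e0 e1 e2 hs.
- have [|||||||||? ? ?] := @opposite_cone_small R b (- a - b) a p1 p2 l => //; lra.
- have [|||||||||? ? ?] := @opposite_cone_small R a (- a - b) b p0 p2 l => //; lra.
- have [|||||||||? ? ?] := @opposite_cone_small R a b (- a - b) p0 p1 l => //; lra.
Qed.

Section real_functions.
Context (R : realType) (T : topologicalType).
Implicit Types f g : T -> R.

Lemma addf_continuous f g : continuous f -> continuous g ->
  continuous (fun x => f x + g x).
Proof. by move=> cf cg x; apply: cvgD; [exact: cf|exact: cg]. Qed.

Lemma oppf_continuous f : continuous f -> continuous (fun x => - f x).
Proof. by move=> cf x; apply: cvgN; exact: cf. Qed.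

Lemma mulf_continuous f g : continuous f -> continuous g ->
  continuous (fun x => f x * g x).
Proof. by move=> cf cg x; apply: cvgM; [exact: cf|exact: cg]. Qed.

Lemma scalef_continuous (a : R) f : continuous f -> continuous (fun x => a * f x).
Proof. by move=> cf; apply: mulf_continuous => // x; exact: cvg_cst. Qed.

Lemma divf_continuous f g : continuous f -> continuous g -> (forall x, g x != 0) ->
  continuous (fun x => f x / g x).
Proof.
by move=> cf cg g0 x; apply: cvgM; [exact: cf|apply: cvgV; [exact: g0|exact: cg]].
Qed.

End real_functions.

(** Extend f = (f1, f2) to a map g into the plane.  The three open sets on which a
    coordinate of (g1, g2, - g1 - g2) exceeds -1/4 cover T, since these
    coordinates have sum 0.  Shrink them to a cover in which no point lies in all
    three sets, and let G be the combination of the vectors (2, -1, -1),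
    (-1, 2, -1), (-1, -1, 2) with weights positive exactly on these sets.  At
    each point at most two weights are positive, and not all vanish, so G avoids
    0.  On A the direction of G is never opposite to f, so half the angle from G
    to f has a bounded continuous tangent t on A.  Extend t to T and turn G by the
    corresponding angle. *)
Lemma circle_extension (R : realType) (T : topologicalType) (d : T -> T -> R)
    (hd : compatible_metric d) (A : set T) (f1 f2 : T -> R) :
  compact [set: T] -> covering_dim_le T 1 -> closed A ->
  {within A, continuous f1} -> {within A, continuous f2} ->
  (forall x, A x -> f1 x ^+ 2 + f2 x ^+ 2 = 1) ->
  exists F1 F2 : T -> R, [/\ continuous F1, continuous F2,
    forall x, F1 x ^+ 2 + F2 x ^+ 2 = 1 &
    forall x, A x -> F1 x = f1 x /\ F2 x = f2 x].
Proof.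
move=> cT dimT cA cf1 cf2 f12.
have nT : normal_space T by apply: compact_normal => //; exact: dist_hausdorff hd.
have f1b x : A x -> `|f1 x| <= 1.
  by move=> /f12 h; rewrite ler_norml; apply/andP; split; nra.
have f2b x : A x -> `|f2 x| <= 1.
  by move=> /f12 h; rewrite ler_norml; apply/andP; split; nra.
have [g1 [g1f cg1 _]] := continuous_bounded_extension nT cA ltr01 cf1 f1b.
have [g2 [g2f cg2 _]] := continuous_bounded_extension nT cA ltr01 cf2 f2b.
have {}g1f x : A x -> g1 x = f1 x by move=> /mem_set/g1f.
have {}g2f x : A x -> g2 x = f2 x by move=> /mem_set/g2f.
have g12 x : A x -> g1 x ^+ 2 + g2 x ^+ 2 = 1.
  by move=> Ax; rewrite g1f// g2f//; exact: f12.
pose gi (i : 'I_3) x : R := [:: g1 x; g2 x; - g1 x - g2 x]`_i.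
have cgi i : continuous (gi i).
  case: i => [[|[|[|//]]] hi]; rewrite /gi/=; [exact: cg1|exact: cg2|].
  by apply: addf_continuous; exact: oppf_continuous.
pose U i := [set x | - (1 / 4) < gi i x].
have oU i : open (U i).
  by apply: (open_comp (f := gi i)) (@open_gt _ _) => x _; exact: cgi.
have [|W [oW WU cW nW]] := covering_dim_shrink dimT oU.
  move=> x; apply: contrapT => /forallNP nU.
  have := nU 0; have := nU 1; have := nU (inord 2).
  rewrite /U /gi /= inordK//= => /negP h2 /negP h1 /negP h0.
  by move: h0 h1 h2; rewrite -!leNgt; lra.
have /choice[phi phiP] := fun i => bump_function hd (oW i).
have cphi i : continuous (phi i) by have [] := phiP i.
have phi0 i x : 0 <= phi i x by have [_ + _] := phiP i; exact.
have phiW i x : 0 < phi i x <-> W i x by have [_ _] := phiP i; exact.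
pose p0 := phi 0; pose p1 := phi 1; pose p2 := phi (inord 2).
have ord3 (Q : 'I_3 -> Prop) : (exists i, Q i) -> [\/ Q 0, Q 1 | Q (inord 2)].
  move=> [[[|[|[|//]]] hi] Qi].
  - have e : (0 : 'I_3) = Ordinal hi by exact: val_inj.
    by apply: Or31; rewrite e.
  - have e : (1 : 'I_3) = Ordinal hi by exact: val_inj.
    by apply: Or32; rewrite e.
  - have e : (inord 2 : 'I_3) = Ordinal hi by apply: val_inj; rewrite /= inordK.
    by apply: Or33; rewrite e.
have psum x : 0 < p0 x + p1 x + p2 x.
  have := phi0 0 x; have := phi0 1 x; have := phi0 (inord 2) x.
  rewrite /p0 /p1 /p2.
  by have [/phiW|/phiW|/phiW] := ord3 _ (cW x); lra.
have pzero x : p0 x = 0 \/ p1 x = 0 \/ p2 x = 0.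
  have z i : ~ W i x -> phi i x = 0.
    by move=> nWi; apply/eqP; rewrite eq_le phi0 andbT leNgt; apply/negP => /phiW.
  by rewrite /p0 /p1 /p2; have [/z|/z|/z] := ord3 _ (nW x) => ->; tauto.
pose G1 x := 2 * p0 x - p1 x - p2 x.
pose G2 x := 2 * p1 x - p0 x - p2 x.
have cG1 : continuous G1.
  by do 2?apply: addf_continuous; [apply: scalef_continuous|apply: oppf_continuous..]; exact: cphi.
have cG2 : continuous G2.
  by do 2?apply: addf_continuous; [apply: scalef_continuous|apply: oppf_continuous..]; exact: cphi.
pose N x := G1 x * G1 x + G2 x * G2 x.
have cN : continuous N by apply: addf_continuous; exact: mulf_continuous.
have N0 x : 0 < N x.
  rewrite ltNge; apply/negP; rewrite /N -!expr2 => N_le0.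
  have G10 : G1 x = 0.
    apply/eqP; rewrite -sqrf_eq0 eq_le sqr_ge0 andbT.
    by have := sqr_ge0 (G2 x); lra.
  have G20 : G2 x = 0.
    apply/eqP; rewrite -sqrf_eq0 eq_le sqr_ge0 andbT.
    by have := sqr_ge0 (G1 x); lra.
  have := psum x; move: G10 G20; rewrite /G1 /G2.
  by have [->|[->|->]] := pzero x; lra.
pose s x := Num.sqrt (N x).
have cs : continuous s.
  exact: (@continuousT_comp T R R N (@Num.sqrt R) cN (@sqrt_continuous R)).
have s0 x : 0 < s x by rewrite sqrtr_gt0.
have sN x : s x ^+ 2 = N x by rewrite sqr_sqrtr// ltW.
(* a + i b is f times the complex conjugate of G, of modulus s on A *)
pose a x := g1 x * G1 x + g2 x * G2 x.
pose b x := g2 x * G1 x - g1 x * G2 x.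
have ca : continuous a by apply: addf_continuous; exact: mulf_continuous.
have cb : continuous b.
  by apply: addf_continuous; [|apply: oppf_continuous]; exact: mulf_continuous.
have abs x : A x -> a x ^+ 2 + b x ^+ 2 = s x ^+ 2.
  move=> Ax; rewrite sN -[N x]mul1r -(g12 x Ax) /a /b /N; ring.
(* s + a vanishes only if b = 0 and a < 0, that is, if G is opposite to f *)
have sa x : A x -> 0 < s x + a x.
  move=> Ax; rewrite ltNge; apply/negP => sa0.
  have a0 : a x < 0 by have := s0 x; lra.
  have sqle : s x ^+ 2 <= a x ^+ 2 by have := s0 x; nra.
  have b0 : b x = 0.
    apply/eqP; rewrite -sqrf_eq0 eq_le sqr_ge0 andbT.
    by have := abs x Ax; lra.
  have cross : g1 x * G2 x = g2 x * G1 x by move: b0; rewrite /b; lra.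
  have e1 : G1 x = a x * g1 x.
    rewrite -[LHS]mul1r -(g12 x Ax) /a.
    transitivity (g1 x * g1 x * G1 x + g2 x * (g2 x * G1 x)); first by ring.
    by rewrite -cross; ring.
  have e2 : G2 x = a x * g2 x.
    rewrite -[LHS]mul1r -(g12 x Ax) /a.
    transitivity (g1 x * (g1 x * G2 x) + g2 x * g2 x * G2 x); first by ring.
    by rewrite cross; ring.
  have WU' i : 0 < phi i x -> - (1 / 4) < gi i x by move=> /phiW /WU.
  apply: (@cone_avoids_opposite R (g1 x) (g2 x) (p0 x) (p1 x) (p2 x) (- a x)).
  - exact: g12.
  - exact: phi0.
  - exact: phi0.
  - exact: phi0.
  - exact: psum.
  - exact: pzero.
  - exact: WU'.
  - exact: WU'.
  - by move=> /WU'; rewrite /gi inordK//= opprD.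
  - by rewrite oppr_gt0.
  - by rewrite opprK -e1.
  - by rewrite opprK -e2.
pose t x := b x / (s x + a x).
have ct : {within A, continuous t}.
  apply: continuous_in_subspaceT => x /set_mem Ax.
  apply: cvgM; first exact: cb.
  apply: cvgV; first by rewrite gt_eqF// sa.
  by apply: cvgD; [exact: cs|exact: ca].
have [M [M0 tM]] : exists M, 0 < M /\ forall x, A x -> `|t x| <= M.
  have : compact (t @` A).
    by apply: continuous_compact => //; exact: subclosed_compact cA cT _.
  move=> /compact_bounded[M [_ MP]]; exists (`|M| + 1); split.
    by rewrite ltr_wpDl.
  move=> x Ax; apply: (MP (`|M| + 1)); last by exists x.
  by rewrite ltr_pwDr// ler_norm.
have [u [tu cu _]] := continuous_bounded_extension nT cA M0 ct tM.
have {}tu x : A x -> t x = u x by move=> /mem_set/tu.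
pose v x := 1 + u x * u x.
have cv : continuous v.
  by apply: addf_continuous; [move=> x; exact: cvg_cst|exact: mulf_continuous].
have v0 x : 0 < v x by rewrite /v; have := sqr_ge0 (u x); rewrite expr2; lra.
(* cosine and sine of the angle whose half has tangent u *)
pose c1 x := (1 - u x * u x) / v x.
pose c2 x := (2 * u x) / v x.
have cc1 : continuous c1.
  apply: divf_continuous => // [|x]; last by rewrite gt_eqF.
  apply: addf_continuous; first by move=> x; exact: cvg_cst.
  by apply: oppf_continuous; exact: mulf_continuous.
have cc2 : continuous c2.
  apply: divf_continuous => // [|x]; last by rewrite gt_eqF.
  exact: scalef_continuous.
have c12 x : c1 x ^+ 2 + c2 x ^+ 2 = 1.
  have vx0 : v x != 0 by rewrite gt_eqF.
  by rewrite /c1 /c2; move: vx0; rewrite /v => vx0; field.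
exists (fun x => (G1 x * c1 x - G2 x * c2 x) / s x),
       (fun x => (G2 x * c1 x + G1 x * c2 x) / s x).
have sn0 x : s x != 0 by rewrite gt_eqF.
split.
- apply: divf_continuous => //; apply: addf_continuous; first exact: mulf_continuous.
  by apply: oppf_continuous; exact: mulf_continuous.
- by apply: divf_continuous => //; apply: addf_continuous; exact: mulf_continuous.
- move=> x; rewrite !expr_div_n -mulrDl sN.
  have -> : (G1 x * c1 x - G2 x * c2 x) ^+ 2 + (G2 x * c1 x + G1 x * c2 x) ^+ 2 =
    N x * (c1 x ^+ 2 + c2 x ^+ 2) by rewrite /N; ring.
  by rewrite c12 mulr1 divff// gt_eqF.
- move=> x Ax; have [h1 h2] := half_angle (s0 x) (abs x Ax) (sa x Ax).
  have Nn0 : N x != 0 by rewrite gt_eqF.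
  have -> : c1 x = a x / s x by rewrite -h1 -/(t x) tu// expr2.
  have -> : c2 x = b x / s x by rewrite -h2 -/(t x) tu// expr2.
  rewrite -g1f// -g2f//; split.
    transitivity ((G1 x * a x - G2 x * b x) / s x ^+ 2); first by field.
    rewrite sN; apply: (mulIf Nn0); rewrite divfK//.
    by rewrite /a /b /N; ring.
  transitivity ((G2 x * a x + G1 x * b x) / s x ^+ 2); first by field.
  rewrite sN; apply: (mulIf Nn0); rewrite divfK//.
  by rewrite /a /b /N; ring.
Qed.

(** * A rotation of infinite order *)

Lemma pair_continuous (S T U : topologicalType) (f : S -> T) (g : S -> U) :
  continuous f -> continuous g -> continuous (fun x => (f x, g x)).
Proof. by move=> cf cg x; apply: cvg_pair; [exact: cf|exact: cg]. Qed.

Section rotation.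
Variable R : realType.

(** Multiplication by (3 + 4 i) / 5. *)
Definition rotate (q : R * R) : R * R :=
  (3 / 5 * q.1 - 4 / 5 * q.2, 4 / 5 * q.1 + 3 / 5 * q.2).

Lemma rotate_circle q : circle q -> circle (rotate q).
Proof.
rewrite /circle /rotate /= => qq; lra.
Qed.

Definition circle_rotation (p : circle_type R) : circle_type R :=
  to_subtype (rotate_circle (subtype_valP p)).

Lemma circle_rotation_continuous : continuous circle_rotation.
Proof.
pose x (q : circle_type R) := (set_val q).1.
pose y (q : circle_type R) := (set_val q).2.
have cx : continuous x.
  move=> q; apply: continuous_comp; first exact: subtype_val_continuous.
  exact: cvg_fst.
have cy : continuous y.
  move=> q; apply: continuous_comp; first exact: subtype_val_continuous.
  exact: cvg_snd.
apply: subtype_continuous.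
apply: (@pair_continuous _ R R (fun p => 3 / 5 * x p - 4 / 5 * y p)
  (fun p => 4 / 5 * x p + 3 / 5 * y p)).
  apply: addf_continuous; first exact: scalef_continuous.
  by apply: oppf_continuous; exact: scalef_continuous.
by apply: addf_continuous; exact: scalef_continuous.
Qed.

(** The real and imaginary parts of (3 + 4 i)^n. *)
Fixpoint gauss_power n : int * int :=
  if n is m.+1 then let z := gauss_power m in
    (3 * z.1 - 4 * z.2, 4 * z.1 + 3 * z.2)
  else (1, 0).

(** Since (3 + 4 i)^2 is congruent to 3 + 4 i modulo 5, the imaginary part of a
    positive power is never 0, and the rotation has infinite order. *)
Lemma gauss_power_mod5 n : exists k l : int,
  gauss_power n.+1 = (5 * k + 3, 5 * l + 4).
Proof.
elim: n => [|n [k [l e]]]; first by exists 0, 0.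
have -> : gauss_power n.+2 = (3 * (gauss_power n.+1).1 - 4 * (gauss_power n.+1).2,
  4 * (gauss_power n.+1).1 + 3 * (gauss_power n.+1).2) by [].
rewrite e /=; exists (3 * k - 4 * l - 2), (4 * k + 3 * l + 4).
by congr pair; ring.
Qed.

Lemma circle_rotation_iter n (p : circle_type R) :
  let z := gauss_power n in
  let q := set_val (iter n circle_rotation p) in
  5 ^+ n * q.1 = z.1%:~R * (set_val p).1 - z.2%:~R * (set_val p).2 /\
  5 ^+ n * q.2 = z.2%:~R * (set_val p).1 + z.1%:~R * (set_val p).2.
Proof.
elim: n => [|n [IH1 IH2]] /=; first by rewrite !mul1r !mul0r subr0 add0r.
set q := iter n _ _ in IH1 IH2 *; set z := gauss_power n in IH1 IH2 *.
rewrite !(intrD, intrM, intrN, intrB) !exprS; split.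
  transitivity (3 * (5 ^+ n * (set_val q).1) - 4 * (5 ^+ n * (set_val q).2)).
    by field.
  by rewrite IH1 IH2; ring.
transitivity (4 * (5 ^+ n * (set_val q).1) + 3 * (5 ^+ n * (set_val q).2)).
  by field.
by rewrite IH1 IH2; ring.
Qed.

Lemma circle_rotation_aperiodic n (p : circle_type R) :
  iter n.+1 circle_rotation p <> p.
Proof.
move=> e; have [] := circle_rotation_iter n.+1 p; rewrite e.
have [k [l ->]] := gauss_power_mod5 n.
set x := (set_val p).1; set y := (set_val p).2; set a := 5 * k + 3; set b := 5 * l + 4.
rewrite [_.1]/= [_.2]/= => e1 e2.
have xy : x ^+ 2 + y ^+ 2 = 1 by exact: (subtype_valP p).
have : b%:~R = 0 :> R.
  transitivity (b%:~R * (x ^+ 2 + y ^+ 2)); first by rewrite xy mulr1.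
  transitivity (x * (b%:~R * x + a%:~R * y) - y * (a%:~R * x - b%:~R * y)).
    by ring.
  by rewrite -e1 -e2; ring.
by move/eqP; rewrite intr_eq0 => /eqP; rewrite /b; lia.
Qed.

End rotation.

(** * Local properties and local dendrites *)

Lemma iter_subtype (T : Type) (A : set T) (f : T -> T) (g : set_type A -> set_type A) x n :
  (forall y, set_val (g y) = f (set_val y)) ->
  set_val (iter n g x) = iter n f (set_val x).
Proof. by move=> gf; elim: n => //= n IH; rewrite gf IH. Qed.

Lemma restrict_self_map (T : topologicalType) (U : set T) (f : T -> T) :
  continuous f -> f @` closure U `<=` U ->
  exists2 g : set_type (closure U) -> set_type (closure U), continuous g &
    forall y, set_val (g y) = f (set_val y).
Proof.
move=> cf fU.
have fcl (y : set_type (closure U)) : closure U (f (set_val y)).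
  by apply: subset_closure; apply: fU; exists (set_val y) => //; exact: subtype_valP.
exists (fun y => to_subtype (fcl y)) => //.
apply: subtype_continuous.
by apply: (continuousT_comp _ cf); exact: subtype_val_continuous.
Qed.

Lemma LPPP_wLPPP (T : topologicalType) : LPPP T -> wLPPP T.
Proof.
move=> [B bB BP]; exists B => // U f BU cf fU.
have [g cg gf] := restrict_self_map cf fU.
have [x [[//|n] _ gx]] := BP U BU g cg.
have fx : iter n.+1 f (set_val x) = set_val x by rewrite -(iter_subtype _ _ gf) gx.
exists (set_val x); last by exists n.+1.
rewrite -fx iterS -(iter_subtype _ _ gf); apply: fU.
by exists (set_val (iter n g x)) => //; exact: subtype_valP.
Qed.

Lemma LFPP_wLFPP (T : topologicalType) : LFPP T -> wLFPP T.
Proof.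
move=> [B bB BP]; exists B => // U f BU cf fU.
have [g cg gf] := restrict_self_map cf fU.
have [x gx] := BP U BU g cg.
exists (set_val x); last by rewrite -gf gx.
rewrite -gx gf; apply: fU.
by exists (set_val x) => //; exact: subtype_valP.
Qed.

Lemma FPP_PPP (T : topologicalType) : FPP T -> PPP T.
Proof. by move=> H f /H[x fx]; exists x, 1%N. Qed.

Lemma LFPP_LPPP (T : topologicalType) : LFPP T -> LPPP T.
Proof. by move=> [B bB BP]; exists B => // U /BP; exact: FPP_PPP. Qed.

Lemma wLFPP_wLPPP (T : topologicalType) : wLFPP T -> wLPPP T.
Proof.
move=> [B bB BP]; exists B => // U f BU cf fU.
by have [x Ux fx] := BP U f BU cf fU; exists x => //; exists 1%N.
Qed.

(** A simple closed curve given by a parametrization moves between a space and its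
    subspaces by composition. *)
Definition curve_in (R : realType) (T : topologicalType) (A : set T) :=
  exists c : circle_type R -> T, [/\ continuous c, injective c & range c `<=` A].

Section continuum.
Context (R : realType) (T : topologicalType) (d : T -> T -> R).
Hypothesis hd : compatible_metric d.
Hypothesis cT : compact [set: T].
Hypothesis lc : locally_connected T.

Lemma subtype_dendrite (A : set T) : closed A -> A !=set0 -> connected A ->
  locally_connected (set_type A) -> ~ curve_in R A -> dendrite R (set_type A).
Proof.
move=> cA [a Aa] coA lcA nc; split=> //.
  split; first by exists (to_subtype Aa).
  - by apply: subtype_compact; exact: subclosed_compact cA cT _.
  - exact: subtype_connected.
  - exact: dist_metrizable (subtype_metric A hd).
move=> [S /simple_closed_curve_param[c [cc ic _]]]; apply: nc.
exists (set_val \o c); split.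
- by apply: continuousT_comp cc _; exact: subtype_val_continuous.
- by move=> p q /= /subtype_val_inj /ic.
- by move=> _ [p _ <-]; exact: subtype_valP.
Qed.

Lemma no_curve_in_dendrite (N A : set T) :
  dendrite R (set_type N) -> A `<=` N -> ~ curve_in R A.
Proof.
move=> [_ _ nS] AN [c [cc ic cA]]; apply: nS.
have cN p : N (c p) by apply: AN; apply: cA; exists p.
exists (range (fun p => to_subtype (cN p))).
apply: injective_circle_curve.
- exact: dist_hausdorff (subtype_metric N hd).
- exact: subtype_continuous.
- by move=> p q /(congr1 set_val) /= /ic.
Qed.

Lemma dendrite_nbhd (x : T) (U : set T) : nbhs x U -> ~ curve_in R U ->
  exists B : set T, [/\ open B, B x, closure B `<=` U &
    dendrite R (set_type (closure B))].
Proof.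
move=> nU ncU.
have [B [oB Bx coB BU lcB]] := locally_connected_closure_nbhd hd cT lc nU.
exists B; split=> //; apply: subtype_dendrite => //.
- exact: closed_closure.
- by exists x; exact: subset_closure.
- exact: connected_closure.
- by move=> [c [cc ic cB]]; apply: ncU; exists c; split=> //; exact: subset_trans BU.
Qed.

Lemma local_dendrite_LFPP : local_dendrite R T -> LFPP T.
Proof.
move=> [_ ld].
exists [set B | [/\ open B, B !=set0 & FPP (set_type (closure B))]]; last first.
  by move=> U [].
split; last by move=> U [].
split; first by move=> U [].
move=> x V nV; have [N [_ nN dN]] := ld x.
have nVN : nbhs x (V `&` N) by exact: filterI.
have [|B [oB Bx BVN dB]] := dendrite_nbhd nVN.
  by apply: no_curve_in_dendrite dN _ => y [].
exists B.
  by split=> //; split=> //; [exists x|exact: dendrite_FPP dB].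
by move=> y /= /(@subset_closure _ B) /BVN[].
Qed.

(** The map retracts T onto the curve and then rotates the curve.  A periodic point
    lies on the curve, where the map is conjugate to the rotation. *)
Lemma curve_aperiodic_map (B : set T) : covering_dim_le T 1 -> curve_in R B ->
  exists f : T -> T, [/\ continuous f, range f `<=` B &
    forall x, ~ periodic_point f x].
Proof.
move=> dimT [c [cc ic cB]].
have hT := dist_hausdorff hd.
have cS : compact [set: circle_type R] by exact/subtype_compact/circle_compact.
have c10 : @circle R (1, 0) by rewrite /circle /= expr1n expr0n addr0.
have /choice[g gP] : forall x, exists p, (range c) x -> c p = x.
  move=> x; have [[p _ <-]|nx] := pselect ((range c) x); first by exists p.
  by exists (to_subtype c10).
have gc p : g (c p) = p by apply: ic; apply: gP; exists p.
have cg : continuous (fun y : set_type (range c) => g (set_val y)).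
  by apply: compact_injection_inverse => // y; apply: gP; exact: subtype_valP.
have within_g (h : R * R -> R) : continuous h ->
    {within range c, continuous (fun x => h (set_val (g x)))}.
  move=> ch; apply/subspace_sigL_continuousP.
  apply: continuousT_comp ch; apply: continuousT_comp cg _.
  exact: subtype_val_continuous.
have clc : closed (range c).
  apply: compact_closed => //; apply: continuous_compact cS.
  exact: continuous_subspaceT.
have cfst : continuous (fun q : R * R => q.1) by move=> q; exact: cvg_fst.
have csnd : continuous (fun q : R * R => q.2) by move=> q; exact: cvg_snd.
have [F1 [F2 [cF1 cF2 F12 FE]]] := circle_extension hd cT dimT clc
  (within_g _ cfst) (within_g _ csnd) (fun x _ => subtype_valP (g x)).
have FS x : @circle R (F1 x, F2 x) by exact: F12.
pose h x : circle_type R := to_subtype (FS x).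
have ch : continuous h by apply: subtype_continuous; exact: pair_continuous.
have hc p : h (c p) = p.
  apply: subtype_val_inj; rewrite -[RHS]/(set_val p).
  have [] := FE (c p) (imageT c p); rewrite gc => e1 e2.
  transitivity (F1 (c p), F2 (c p)); first by [].
  by rewrite e1 e2 -surjective_pairing.
pose f x := c (circle_rotation (h x)).
exists f; split.
- apply: continuousT_comp cc; apply: continuousT_comp ch _.
  exact: circle_rotation_continuous.
- by move=> _ [x _ <-]; apply: cB; exists (circle_rotation (h x)).
- move=> x [[//|n] _ fx].
  pose p := circle_rotation (h (iter n f x)).
  have xE : x = c p by rewrite -fx.
  have iter_f m : iter m f (c p) = c (iter m (@circle_rotation R) p).
    by elim: m => //= m ->; rewrite /f hc.
  apply: (@circle_rotation_aperiodic R n p); apply: ic.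
  by rewrite -iter_f -xE.
Qed.

Lemma wLPPP_local_dendrite : covering_dim_le T 1 -> metric_continuum R T ->
  wLPPP T -> local_dendrite R T.
Proof.
move=> dimT mT [B [[oB bB] _] BP]; split=> // x; apply: contrapT => noN.
have curves U : nbhs x U -> curve_in R U.
  move=> nU; apply: contrapT => ncU; apply: noN.
  have [V [oV Vx _ dV]] := dendrite_nbhd nU ncU.
  exists (closure V); split=> //; first exact: closed_closure.
  by apply: filterS (open_nbhs_nbhs (conj oV Vx)); exact: subset_closure.
have [U [BU Ux] _] := bB x _ (@filterT _ (nbhs x) _).
have nU : nbhs x U by apply: open_nbhs_nbhs; split=> //; exact: oB.
have [f [cf fU noper]] := curve_aperiodic_map dimT (curves U nU).
have [|y _ fy] := BP U f BU cf; last exact: noper fy.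
by move=> _ [z _ <-]; apply: fU; exists z.
Qed.

End continuum.

Theorem theorem7 (R : realType) (X : topologicalType)
    (hX : metric_continuum R X) (hlc : locally_connected X)
    (hdim : one_dimensional X) :
  [<-> LPPP X;
       wLPPP X;
       local_dendrite R X;
       LFPP X;
       wLFPP X].
Proof.
have [_ cX _ /metrizable_dist[d hd]] := hX.
have wLPPP_ld : wLPPP X -> local_dendrite R X.
  by apply: (wLPPP_local_dendrite hd) => //; case: hdim.
have ld_LFPP : local_dendrite R X -> LFPP X by exact: (local_dendrite_LFPP hd).
tfae => //.
- exact: LPPP_wLPPP.
- exact: LFPP_wLFPP.
- by move=> /wLFPP_wLPPP /wLPPP_ld /ld_LFPP /LFPP_LPPP.
Qed.
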